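(* In the confocal pair, from $X_1$ to $X_{200}$, the locus of the triangle center $X_k$ over the family of Poncelet triangles is an ellipse for $k=1, 2, 3, 4, 5, 7, 8, 10, 11, 12, 20, 21, 35, 36, 40, 46, 55, 56, 57, 63, 65, 72, 78, 79, 80, 84, 88, 90, 100, 104, 119, 140, 142, 144, 145, 149, 153, 162, 165, 190, 191, 200$.
   Context: Confocal pair: the outer ellipse is $\frac{X^2}{a^2}+\frac{Y^2}{b^2}=1$ with $a>b>0$; put $c^2=a^2-b^2$ and $\delta=\sqrt{a^4-a^2b^2+b^4}$. The inner ellipse (caustic) is the ellipse confocal with it having semi-axes $a_c=a(\delta-b^2)/c^2$ along the $X$-axis and $b_c=b(a^2-\delta)/c^2$ along the $Y$-axis. This is the confocal ellipse for which triangles exist that are inscribed in the outer ellipse and have all side lines tangent to the inner one; these are the Poncelet triangles, and every point of the outer ellipse is a vertex of exactly one of them. The locus of a center is the set of its positions over all triangles of the family. Circles count as ellipses; an elliptic locus one or both of whose axes have shrunk to zero (a segment or a point) is called degenerate. Triangle centers (Kimberling's numbering). For a triangle with vertices $V_1,V_2,V_3$ and opposite sidelengths $s_1,s_2,s_3$, write $[h]$ for the point with homogeneous barycentric coordinates $h(s_1,s_2,s_3):h(s_2,s_3,s_1):h(s_3,s_1,s_2)$. In the formulas for $h(x,y,z)$ below, put $\kappa_x=\frac{y^2+z^2-x^2}{2yz}$, $\kappa_y=\frac{z^2+x^2-y^2}{2zx}$, $\kappa_z=\frac{x^2+y^2-z^2}{2xy}$ (cosines of the angles opposite $x,y,z$).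 Homogeneous coordinates with vanishing denominators are to be read after multiplying all three coordinates by the product of the three denominators. Equations between points are affine combinations. $X_1=[x]$ (incenter); $X_2=[1]$ (barycenter); $X_3=[x^2(y^2+z^2-x^2)]$ (circumcenter); $X_4=3X_2-2X_3$; $X_5=\frac12(3X_2-X_3)$; $X_7=[1/(y+z-x)]$; $X_8=[y+z-x]$; $X_9=[x(y+z-x)]$; $X_{10}=[y+z]$; $X_{11}=[(y-z)^2(y+z-x)]$; $X_{12}=[(y+z)^2/(y+z-x)]$; $X_{20}=4X_3-3X_2$; $X_{21}=[x(y+z-x)/(y+z)]$; $X_{35}=[x(1+2\kappa_x)]$; $X_{36}=[x(1-2\kappa_x)]$; $X_{40}=2X_3-X_1$; $X_{46}=[x(\kappa_y+\kappa_z-\kappa_x)]$; $X_{55}=[x^2(y+z-x)]$; $X_{56}=[x^2/(y+z-x)]$; $X_{57}=[x/(y+z-x)]$; $X_{63}=[x(y^2+z^2-x^2)]$; $X_{65}=[x(y+z)/(y+z-x)]$; $X_{72}=[x(y+z)(y^2+z^2-x^2)]$; $X_{78}=[x(y+z-x)(y^2+z^2-x^2)]$; $X_{79}=[1/(y^2+z^2-x^2+yz)]$; $X_{80}=2X_{11}-X_1$; $X_{84}=[x/(\kappa_y+\kappa_z-\kappa_x-1)]$; $X_{88}=[x/(y+z-2x)]$; $X_{90}=[x/(\kappa_y+\kappa_z-\kappa_x)]$; $X_{100}=3X_2-2X_{11}$; $X_{104}=2X_3-X_{100}$; $X_{119}=2X_5-X_{11}$; $X_{140}=\frac12(X_3+X_5)$;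 $X_{142}=\frac12(3X_2-X_9)$; $X_{144}=3X_2-2X_7$; $X_{145}=3X_2-2X_8$; $X_{149}=3X_2-2X_{100}$; $X_{153}=3X_2-2X_{104}$; $X_{162}=[x/((y^2-z^2)(y^2+z^2-x^2))]$; $X_{165}=\frac13(4X_3-X_1)$; $X_{190}=[1/(y-z)]$; $X_{191}=2X_{21}-X_1$; $X_{200}=[x(y+z-x)^2]$.
   Formalization: For k=90 the case a²=(2√2−1)b² is excluded: there X_90 is at infinity for every Poncelet triangle, so the locus is empty. For k=35 with a²=(2√2−1)b² and k=140 with a²=((9−√17)/2)b² the ellipse is degenerate (a segment). *)

(* Defs.v *)
From Stdlib Require Import Reals List.
Open Scope R_scope.

Definition point := (R * R)%type.

Definition distance (P Q : point) : R := dist_euc (fst P) (snd P) (fst Q) (snd Q).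

Definition on_line (P Q M : point) : Prop :=
  exists t, M = ((1 - t) * fst P + t * fst Q, (1 - t) * snd P + t * snd Q).

(* The ellipse centred at the origin with semi-axes p (along X) and q (along Y). *)
Definition on_ellipse (p q : R) (M : point) : Prop :=
  fst M ^ 2 / p ^ 2 + snd M ^ 2 / q ^ 2 = 1.

(* A line is tangent to an ellipse iff it meets it in exactly one point. *)
Definition tangent_line (P Q : point) (p q : R) : Prop :=
  P <> Q /\ exists! M, on_line P Q M /\ on_ellipse p q M.

Definition delta (a b : R) : R := sqrt (a ^ 4 - a ^ 2 * b ^ 2 + b ^ 4).
Definition caustic_x (a b : R) : R := a * (delta a b - b ^ 2) / (a ^ 2 - b ^ 2).
Definition caustic_y (a b : R) : R := b * (a ^ 2 - delta a b) / (a ^ 2 - b ^ 2).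

Record triangle := Triangle { V1 : point; V2 : point; V3 : point }.

(* Distinct points of an ellipse are never collinear, and [tangent_line] forces
   the vertices to be distinct, so such a triangle is automatically proper. *)
Definition poncelet (a b : R) (T : triangle) : Prop :=
  (on_ellipse a b (V1 T) /\ on_ellipse a b (V2 T) /\ on_ellipse a b (V3 T)) /\
  (tangent_line (V2 T) (V3 T) (caustic_x a b) (caustic_y a b) /\
   tangent_line (V3 T) (V1 T) (caustic_x a b) (caustic_y a b) /\
   tangent_line (V1 T) (V2 T) (caustic_x a b) (caustic_y a b)).

(* A center is a partial function from triangles to points, given by its graph:
   it has no position when its homogeneous coordinates add up to zero (point at
   infinity) or all vanish. *)
Definition center := triangle -> point -> Prop.

Definition barycentric (h : R -> R -> R -> R) : center := fun T M =>
  let s1 := distance (V2 T) (V3 T) in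
  let s2 := distance (V3 T) (V1 T) in
  let s3 := distance (V1 T) (V2 T) in
  let w1 := h s1 s2 s3 in
  let w2 := h s2 s3 s1 in
  let w3 := h s3 s1 s2 in
  let w := w1 + w2 + w3 in
  w <> 0 /\
  M = ((w1 * fst (V1 T) + w2 * fst (V2 T) + w3 * fst (V3 T)) / w,
       (w1 * snd (V1 T) + w2 * snd (V2 T) + w3 * snd (V3 T)) / w).

(* [num / den], all coordinates being multiplied by
   den(x,y,z) den(y,z,x) den(z,x,y) so that vanishing denominators make sense. *)
Definition barycentric_ratio (num den : R -> R -> R -> R) : center :=
  barycentric (fun x y z => num x y z * den y z x * den z x y).

Definition combination (c : R) (F : center) (d : R) (G : center) : center :=
  fun T M => exists P Q, F T P /\ G T Q /\
    M = (c * fst P + d * fst Q, c * snd P + d * snd Q).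

(* Cosine of the angle opposite x; those opposite y and z are
   [kappa y z x] and [kappa z x y]. *)
Definition kappa (x y z : R) : R := (y ^ 2 + z ^ 2 - x ^ 2) / (2 * y * z).

Definition X1 := barycentric (fun x y z => x).
Definition X2 := barycentric (fun x y z => 1).
Definition X3 := barycentric (fun x y z => x ^ 2 * (y ^ 2 + z ^ 2 - x ^ 2)).
Definition X4 := combination 3 X2 (- 2) X3.
Definition X5 := combination (3 / 2) X2 (- (1 / 2)) X3.
Definition X7 := barycentric_ratio (fun x y z => 1) (fun x y z => y + z - x).
Definition X8 := barycentric (fun x y z => y + z - x).
Definition X9 := barycentric (fun x y z => x * (y + z - x)).
Definition X10 := barycentric (fun x y z => y + z).
Definition X11 := barycentric (fun x y z => (y - z) ^ 2 * (y + z - x)).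
Definition X12 :=
  barycentric_ratio (fun x y z => (y + z) ^ 2) (fun x y z => y + z - x).
Definition X20 := combination 4 X3 (- 3) X2.
Definition X21 :=
  barycentric_ratio (fun x y z => x * (y + z - x)) (fun x y z => y + z).
Definition X35 := barycentric (fun x y z => x * (1 + 2 * kappa x y z)).
Definition X36 := barycentric (fun x y z => x * (1 - 2 * kappa x y z)).
Definition X40 := combination 2 X3 (- 1) X1.
Definition X46 :=
  barycentric (fun x y z => x * (kappa y z x + kappa z x y - kappa x y z)).
Definition X55 := barycentric (fun x y z => x ^ 2 * (y + z - x)).
Definition X56 := barycentric_ratio (fun x y z => x ^ 2) (fun x y z => y + z - x).
Definition X57 := barycentric_ratio (fun x y z => x) (fun x y z => y + z - x).
Definition X63 := barycentric (fun x y z => x * (y ^ 2 + z ^ 2 - x ^ 2)).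
Definition X65 :=
  barycentric_ratio (fun x y z => x * (y + z)) (fun x y z => y + z - x).
Definition X72 := barycentric (fun x y z => x * (y + z) * (y ^ 2 + z ^ 2 - x ^ 2)).
Definition X78 :=
  barycentric (fun x y z => x * (y + z - x) * (y ^ 2 + z ^ 2 - x ^ 2)).
Definition X79 :=
  barycentric_ratio (fun x y z => 1) (fun x y z => y ^ 2 + z ^ 2 - x ^ 2 + y * z).
Definition X80 := combination 2 X11 (- 1) X1.
Definition X84 :=
  barycentric_ratio (fun x y z => x)
    (fun x y z => kappa y z x + kappa z x y - kappa x y z - 1).
Definition X88 := barycentric_ratio (fun x y z => x) (fun x y z => y + z - 2 * x).
Definition X90 :=
  barycentric_ratio (fun x y z => x)
    (fun x y z => kappa y z x + kappa z x y - kappa x y z).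
Definition X100 := combination 3 X2 (- 2) X11.
Definition X104 := combination 2 X3 (- 1) X100.
Definition X119 := combination 2 X5 (- 1) X11.
Definition X140 := combination (1 / 2) X3 (1 / 2) X5.
Definition X142 := combination (3 / 2) X2 (- (1 / 2)) X9.
Definition X144 := combination 3 X2 (- 2) X7.
Definition X145 := combination 3 X2 (- 2) X8.
Definition X149 := combination 3 X2 (- 2) X100.
Definition X153 := combination 3 X2 (- 2) X104.
Definition X162 :=
  barycentric_ratio (fun x y z => x)
    (fun x y z => (y ^ 2 - z ^ 2) * (y ^ 2 + z ^ 2 - x ^ 2)).
Definition X165 := combination (4 / 3) X3 (- (1 / 3)) X1.
Definition X190 := barycentric_ratio (fun x y z => 1) (fun x y z => y - z).
Definition X191 := combination 2 X21 (- 1) X1.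
Definition X200 := barycentric (fun x y z => x * (y + z - x) ^ 2).

(* Kimberling's numbering; no position is assigned for the other indices. *)
Definition X (k : nat) : center :=
  match k with
  | 1 => X1 | 2 => X2 | 3 => X3 | 4 => X4 | 5 => X5 | 7 => X7 | 8 => X8
  | 9 => X9 | 10 => X10 | 11 => X11 | 12 => X12 | 20 => X20 | 21 => X21
  | 35 => X35 | 36 => X36 | 40 => X40 | 46 => X46 | 55 => X55 | 56 => X56
  | 57 => X57 | 63 => X63 | 65 => X65 | 72 => X72 | 78 => X78 | 79 => X79
  | 80 => X80 | 84 => X84 | 88 => X88 | 90 => X90 | 100 => X100 | 104 => X104
  | 119 => X119 | 140 => X140 | 142 => X142 | 144 => X144 | 145 => X145
  | 149 => X149 | 153 => X153 | 162 => X162 | 165 => X165 | 190 => X190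
  | 191 => X191 | 200 => X200
  | _ => fun _ _ => False
  end%nat.

Definition locus (a b : R) (F : center) (M : point) : Prop :=
  exists T, poncelet a b T /\ F T M.

(* S is the curve with center C and semi-axes p along the unit vector u and q
   along the orthogonal unit vector (- snd u, fst u). *)
Definition ellipse_with_axes (C u : point) (p q : R) (S : point -> Prop) : Prop :=
  forall M, S M <-> exists t,
    M = (fst C + p * cos t * fst u - q * sin t * snd u,
         snd C + p * cos t * snd u + q * sin t * fst u).

Definition is_ellipse (S : point -> Prop) : Prop :=
  exists (C u : point) (p q : R), fst u ^ 2 + snd u ^ 2 = 1 /\
    0 < p /\ 0 < q /\ ellipse_with_axes C u p q S.

(* A segment (one zero semi-axis) or a point (both zero). *)
Definition is_degenerate_ellipse (S : point -> Prop) : Prop :=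
  exists (C u : point) (p q : R), fst u ^ 2 + snd u ^ 2 = 1 /\
    0 <= p /\ 0 <= q /\ p * q = 0 /\ ellipse_with_axes C u p q S.

(* Main.v *)
Require Import Defs.
From Stdlib Require Import Reals List Lra Psatz.
Import ListNotations.
Open Scope R_scope.

(* Write the outer ellipse as the affine image (a x, b y) of the unit circle and put
   n = a_c/a - b_c/b, so that 0 < n < 1, a_c = a(1+n)/2, b_c = b(1-n)/2 and a^2 : b^2 =
   (1+n)(3-n) : (1-n)(3+n).  A chord joining points u, v of the circle corresponds to a
   tangent of the caustic iff 2(1-n) u_x v_x + 2(1+n) u_y v_y = n^2 - 1, and then its length
   is proportional to 1 - u.v.  Regarding the vertices as complex numbers z_1, z_2, z_3, this
   gives z_1 + z_2 + z_3 = - n l, z_1 z_2 + z_2 z_3 + z_3 z_1 = - n, z_1 z_2 z_3 = l with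
   l = C + i S on the unit circle, and every l occurs.  In terms of the normalised sidelengths
   x, y, z (opposite z_1, z_2, z_3) one finds that
     x + y + z = (9 - n^2)/2,   4(xy + yz + zx) - (x + y + z)^2 = 2xyz,
   that x z_1 + y z_2 + z z_3 has coordinates (- n(3+n) C, - n(3-n) S), and that the
   mittenpunkt stays at the origin.  Barycentric weights reduce to quadratic polynomials in the
   sidelength with symmetric coefficients; the mittenpunkt eliminates the quadratic term, so a
   center is (a C f, b S f') with f, f' depending only on n and on xyz.  For all centers
   concerned but X88, X162 and X190 the dependence on xyz cancels.  These three lie on the
   outer ellipse, and the intermediate value theorem shows that they sweep it out. *)

(** * Poncelet triangles *)

(** The ratios a_c/a and b_c/b add up to 1, so their difference n determines both. Squaring d gives
    a quadratic equation for n, which is the ratio a^2 : b^2 with denominators cleared; the scale g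
    then comes from a^2 - b^2 = 4 n g^2. *)
Lemma confocal_parameters (a b : R) : 0 < b -> b < a ->
  exists n g, 0 < n < 1 /\ 0 < g /\
    a ^ 2 = g ^ 2 * (1 + n) * (3 - n) /\ b ^ 2 = g ^ 2 * (1 - n) * (3 + n) /\
    caustic_x a b = a * ((1 + n) / 2) /\ caustic_y a b = b * ((1 - n) / 2).
Proof.
  intros Hb Hab.
  assert (Hc : 0 < a ^ 2 - b ^ 2) by nra.
  assert (Hb2 : 0 < b ^ 2) by nra.
  assert (Hr : 0 < a ^ 4 - a ^ 2 * b ^ 2 + b ^ 4).
  { replace (a ^ 4 - a ^ 2 * b ^ 2 + b ^ 4)
      with ((a ^ 2 - b ^ 2) ^ 2 + a ^ 2 * b ^ 2) by ring. nra. }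
  unfold caustic_x, caustic_y, delta.
  set (d := sqrt _).
  assert (Hd0 : 0 < d) by (apply sqrt_lt_R0; exact Hr).
  assert (Hd : d ^ 2 = a ^ 4 - a ^ 2 * b ^ 2 + b ^ 4).
  { unfold d. rewrite pow2_sqrt; lra. }
  (* Here 4 d^2 - (a^2 + b^2)^2 = 3 (a^2 - b^2)^2 and, next, a^4 - d^2 = b^2 (a^2 - b^2). *)
  assert (Hd1 : a ^ 2 + b ^ 2 < 2 * d) by nra.
  assert (Hd2 : d < a ^ 2) by nra.
  set (n := (2 * d - a ^ 2 - b ^ 2) / (a ^ 2 - b ^ 2)).
  assert (Hn : n * (a ^ 2 - b ^ 2) = 2 * d - a ^ 2 - b ^ 2) by (unfold n; field; lra).
  assert (Hn0 : 0 < n) by (apply Rdiv_lt_0_compat; lra).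
  assert (Hn1 : n < 1) by nra.
  assert (Hq : 3 * (a ^ 2 - b ^ 2) - 2 * n * (a ^ 2 + b ^ 2) - n ^ 2 * (a ^ 2 - b ^ 2) = 0).
  { apply Rmult_eq_reg_r with (a ^ 2 - b ^ 2); [|lra].
    replace (_ * (a ^ 2 - b ^ 2)) with
      (3 * (a ^ 2 - b ^ 2) ^ 2 - 2 * (n * (a ^ 2 - b ^ 2)) * (a ^ 2 + b ^ 2)
       - (n * (a ^ 2 - b ^ 2)) ^ 2) by ring.
    rewrite Hn. nra. }
  assert (Hg0 : 0 < (a ^ 2 - b ^ 2) / (4 * n)) by (apply Rdiv_lt_0_compat; lra).
  exists n, (sqrt ((a ^ 2 - b ^ 2) / (4 * n))).
  rewrite pow2_sqrt by lra.
  repeat split.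
  - exact Hn0.
  - exact Hn1.
  - apply sqrt_lt_R0; exact Hg0.
  - apply Rmult_eq_reg_r with (4 * n); [|lra].
    transitivity ((a ^ 2 - b ^ 2) * (1 + n) * (3 - n)); [lra | field; lra].
  - apply Rmult_eq_reg_r with (4 * n); [|lra].
    transitivity ((a ^ 2 - b ^ 2) * (1 - n) * (3 + n)); [lra | field; lra].
  - unfold n. field. lra.
  - unfold n. field. lra.
Qed.

(** The reflection t -> - 2B/A - t exchanges the roots, so a unique root is fixed by it and equals -
    B/A. *)
Lemma double_root (A B G : R) : 0 < A ->
  B ^ 2 = A * G <-> exists! t, A * t ^ 2 + 2 * B * t + G = 0.
Proof.
  intros HA. split.
  - intros H. exists (- B / A). split.
    + apply Rmult_eq_reg_l with A; [|lra].
      transitivity (A * G - B ^ 2); [field; lra | lra].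
    + intros t Ht.
      assert (E : (A * t + B) ^ 2 = 0) by nra.
      assert (A * t + B = 0) by nra.
      apply Rmult_eq_reg_l with A; [|lra].
      transitivity (- B); [field; lra | lra].
  - intros [t [Ht U]].
    assert (E : t = - (2 * B) / A - t).
    { apply U. apply Rmult_eq_reg_l with A; [|lra].
      transitivity (A * (A * t ^ 2 + 2 * B * t + G)); [field; lra | rewrite Ht; ring]. }
    assert (E' : A * t = - B).
    { assert (A * t = A * (- (2 * B) / A - t)) by (f_equal; exact E).
      replace (A * (- (2 * B) / A - t)) with (- 2 * B - A * t) in H by (field; lra). lra. }
    assert (A * (A * t ^ 2 + 2 * B * t + G) = 0) by (rewrite Ht; ring).
    nra.
Qed.

Lemma pow2_gt_0 (x : R) : x <> 0 -> 0 < x ^ 2.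
Proof. intros H. rewrite <- Rsqr_pow2. exact (Rsqr_pos_lt x H). Qed.

(** For unit vectors, half the squared distance. *)
Definition chord (x1 y1 x2 y2 : R) : R := 1 - x1 * x2 - y1 * y2.

Lemma chord_pos x1 y1 x2 y2 : x1 ^ 2 + y1 ^ 2 = 1 -> x2 ^ 2 + y2 ^ 2 = 1 ->
  (x1, y1) <> (x2, y2) -> 0 < chord x1 y1 x2 y2.
Proof.
  intros H1 H2 H. unfold chord.
  destruct (Req_dec x1 x2) as [E|E].
  - assert (y1 <> y2) by (intros E'; apply H; subst; reflexivity).
    assert (0 < (y1 - y2) ^ 2) by (apply pow2_gt_0; lra). nra.
  - assert (0 < (x1 - x2) ^ 2) by (apply pow2_gt_0; lra). nra.
Qed.

(** Differences of squares, such as (1 - x1 x2)^2 - (y1 y2)^2 for the first; the last is the Gram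
    determinant 1 - (u.v)^2. They expose the factor [chord], which splits off from the discriminant
    and makes sidelengths free of square roots. *)
Lemma chord_squares x1 y1 x2 y2 : x1 ^ 2 + y1 ^ 2 = 1 -> x2 ^ 2 + y2 ^ 2 = 1 ->
  (x1 - x2) ^ 2 = chord x1 y1 x2 y2 * (1 - x1 * x2 + y1 * y2) /\
  (y1 - y2) ^ 2 = chord x1 y1 x2 y2 * (1 + x1 * x2 - y1 * y2) /\
  (x1 * y2 - x2 * y1) ^ 2 = chord x1 y1 x2 y2 * (1 + x1 * x2 + y1 * y2).
Proof.
  intros H1 H2. unfold chord.
  assert (E1 : y1 ^ 2 = 1 - x1 ^ 2) by lra. assert (E2 : y2 ^ 2 = 1 - x2 ^ 2) by lra.
  repeat split.
  - transitivity (1 - 2 * (x1 * x2) + x1 ^ 2 * x2 ^ 2 - y1 ^ 2 * y2 ^ 2); [|ring].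
    rewrite E1, E2. ring.
  - transitivity (1 - 2 * (y1 * y2) + y1 ^ 2 * y2 ^ 2 - x1 ^ 2 * x2 ^ 2); [|ring].
    replace (x1 ^ 2) with (1 - y1 ^ 2) by lra. replace (x2 ^ 2) with (1 - y2 ^ 2) by lra. ring.
  - transitivity (x1 ^ 2 * y2 ^ 2 + x2 ^ 2 * y1 ^ 2 - 2 * (x1 * x2 * (y1 * y2))); [ring|].
    transitivity (1 - x1 ^ 2 * x2 ^ 2 - y1 ^ 2 * y2 ^ 2 - 2 * (x1 * x2 * (y1 * y2))); [|ring].
    rewrite E1, E2. ring.
Qed.

(** Conjugacy with respect to the imaginary conic x^2/((1+n)/2) + y^2/((1-n)/2) = -1. *)
Definition conjugate (n x1 y1 x2 y2 : R) : Prop :=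
  2 * (1 - n) * (x1 * x2) + 2 * (1 + n) * (y1 * y2) = n ^ 2 - 1.

(** Restricted to the line, the equation of the caustic is quadratic in the line parameter. Its
    discriminant is, up to a nonzero constant, the positive [chord] times the defect in the
    conjugacy relation. *)
Lemma tangent_line_conjugate (n a b x1 y1 x2 y2 : R) :
  0 < n < 1 -> 0 < a -> 0 < b -> x1 ^ 2 + y1 ^ 2 = 1 -> x2 ^ 2 + y2 ^ 2 = 1 ->
  tangent_line (a * x1, b * y1) (a * x2, b * y2) (a * ((1 + n) / 2)) (b * ((1 - n) / 2))
  <-> (x1, y1) <> (x2, y2) /\ conjugate n x1 y1 x2 y2.
Proof.
  intros Hn Ha Hb H1 H2.
  set (P := (a * x1, b * y1)). set (Q := (a * x2, b * y2)).
  assert (Hne : P <> Q <-> (x1, y1) <> (x2, y2)).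
  { split; intros H E; apply H.
    - injection E as -> ->. reflexivity.
    - injection E as E1 E2. f_equal.
      + apply Rmult_eq_reg_l with a; lra.
      + apply Rmult_eq_reg_l with b; lra. }
  set (A := ((x2 - x1) / ((1 + n) / 2)) ^ 2 + ((y2 - y1) / ((1 - n) / 2)) ^ 2).
  set (B := x1 * (x2 - x1) / ((1 + n) / 2) ^ 2 + y1 * (y2 - y1) / ((1 - n) / 2) ^ 2).
  set (G := (x1 / ((1 + n) / 2)) ^ 2 + (y1 / ((1 - n) / 2)) ^ 2 - 1).
  set (line := fun t => ((1 - t) * fst P + t * fst Q, (1 - t) * snd P + t * snd Q)).
  assert (Hon : forall t, on_ellipse (a * ((1 + n) / 2)) (b * ((1 - n) / 2)) (line t)
                 <-> A * t ^ 2 + 2 * B * t + G = 0).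
  { intros t. unfold on_ellipse, line; simpl fst; simpl snd.
    match goal with |- ?l = 1 <-> ?r = 0 => assert (l = r + 1) end.
    { unfold A, B, G. field. lra. }
    split; lra. }
  unfold tangent_line. rewrite Hne. enough (Main : (x1, y1) <> (x2, y2) ->
    ((exists! M, on_line P Q M /\ on_ellipse (a * ((1 + n) / 2)) (b * ((1 - n) / 2)) M)
     <-> conjugate n x1 y1 x2 y2)) by tauto.
  intros N.
  assert (HA : 0 < A).
  { unfold A.
    pose proof (pow2_ge_0 ((x2 - x1) / ((1 + n) / 2))).
    pose proof (pow2_ge_0 ((y2 - y1) / ((1 - n) / 2))).
    destruct (Req_dec x1 x2) as [E|E].
    - assert (y1 <> y2) by (intros E'; apply N; subst; reflexivity).
      assert (0 < ((y2 - y1) / ((1 - n) / 2)) ^ 2); [|lra].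
      apply pow2_gt_0, Rmult_integral_contrapositive_currified;
        [lra | apply Rinv_neq_0_compat; lra].
    - assert (0 < ((x2 - x1) / ((1 + n) / 2)) ^ 2); [|lra].
      apply pow2_gt_0, Rmult_integral_contrapositive_currified;
        [lra | apply Rinv_neq_0_compat; lra]. }
  pose proof (chord_pos _ _ _ _ H1 H2 N) as Hc.
  assert (Hdisc : ((1 + n) / 2) ^ 2 * ((1 - n) / 2) ^ 2 * (A * G - B ^ 2) * 2 =
      chord x1 y1 x2 y2 *
      (2 * (1 - n) * (x1 * x2) + 2 * (1 + n) * (y1 * y2) + 1 - n ^ 2)).
  { destruct (chord_squares x1 y1 x2 y2 H1 H2) as [E1 [E2 E3]].
    (* Lagrange's identity collects the quartic terms into (x1 y2 - x2 y1)^2. *)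
    transitivity (2 * (x1 * y2 - x2 * y1) ^ 2
      - 2 * ((1 - n) / 2) ^ 2 * (x1 - x2) ^ 2 - 2 * ((1 + n) / 2) ^ 2 * (y1 - y2) ^ 2).
    - unfold A, B, G. field. lra.
    - rewrite E1, E2, E3. unfold chord. field. }
  transitivity (exists! t, A * t ^ 2 + 2 * B * t + G = 0).
  - split.
    + intros [M [[[t Ht] HM] U]]. exists t. change (M = line t) in Ht. subst M. split.
      * apply Hon. exact HM.
      * intros t' Ht'.
        assert (E : line t = line t').
        { apply U. split; [exists t'; reflexivity | apply Hon; exact Ht']. }
        unfold line in E; simpl in E. injection E as E1 E2.
        assert (E1' : a * ((t - t') * (x2 - x1)) = 0) by lra.
        assert (E2' : b * ((t - t') * (y2 - y1)) = 0) by lra.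
        apply Rmult_integral in E1', E2'.
        destruct (Req_dec t t') as [?|D]; [assumption|exfalso; apply N].
        destruct E1' as [|E1']; [lra|]. destruct E2' as [|E2']; [lra|].
        apply Rmult_integral in E1', E2'. f_equal; lra.
    + intros [t [Ht U]]. exists (line t). split.
      * split; [exists t; reflexivity | apply Hon; exact Ht].
      * intros M [[t' E] HM]. change (M = line t') in E. subst M.
        rewrite (U t'); [reflexivity | apply Hon; exact HM].
  - rewrite <- (double_root A B G HA). unfold conjugate. split; intros H.
    + rewrite H in Hdisc. apply Rmult_eq_reg_l with (chord x1 y1 x2 y2); lra.
    + replace (2 * (1 - n) * (x1 * x2) + 2 * (1 + n) * (y1 * y2) + 1 - n ^ 2)
        with 0 in Hdisc by lra.
      assert (0 < ((1 + n) / 2) ^ 2 * ((1 - n) / 2) ^ 2)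
        by (apply Rmult_lt_0_compat; apply pow_lt; lra).
      apply Rmult_eq_reg_l with (((1 + n) / 2) ^ 2 * ((1 - n) / 2) ^ 2); lra.
Qed.

(** The squared length is g^2 [chord] (6 - 2n^2 - 4n(x1 x2 - y1 y2)), and conjugacy turns the last
    factor into 4 [chord]. *)
Lemma distance_chord (n g a b x1 y1 x2 y2 : R) :
  0 < g -> a ^ 2 = g ^ 2 * (1 + n) * (3 - n) -> b ^ 2 = g ^ 2 * (1 - n) * (3 + n) ->
  x1 ^ 2 + y1 ^ 2 = 1 -> x2 ^ 2 + y2 ^ 2 = 1 -> 0 < chord x1 y1 x2 y2 ->
  conjugate n x1 y1 x2 y2 ->
  distance (a * x1, b * y1) (a * x2, b * y2) = 2 * g * chord x1 y1 x2 y2.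
Proof.
  intros Hg Ha Hb H1 H2 Hc HK. unfold distance, dist_euc; simpl.
  assert (0 < g * chord x1 y1 x2 y2) by (apply Rmult_lt_0_compat; assumption).
  rewrite <- (sqrt_Rsqr (2 * g * chord x1 y1 x2 y2)) by lra.
  f_equal. unfold Rsqr.
  transitivity (a ^ 2 * (x1 - x2) ^ 2 + b ^ 2 * (y1 - y2) ^ 2); [ring|].
  rewrite Ha, Hb. destruct (chord_squares x1 y1 x2 y2 H1 H2) as [E1 [E2 _]].
  rewrite E1, E2. unfold chord, conjugate in *.
  transitivity (g ^ 2 * (1 - x1 * x2 - y1 * y2) *
    (6 - 2 * n ^ 2 - 4 * n * (x1 * x2 - y1 * y2))); [ring|].
  replace (4 * n * (x1 * x2 - y1 * y2)) with
    (2 * (1 - n ^ 2) + 4 * (x1 * x2 + y1 * y2)) by lra.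
  ring.
Qed.

Lemma conjugate_neq (n x1 y1 x2 y2 : R) : 0 < n < 1 ->
  conjugate n x1 y1 x2 y2 -> (x1, y1) <> (x2, y2).
Proof.
  intros Hn HK E. injection E as -> ->. unfold conjugate in HK.
  assert (0 <= (1 - n) * (x2 * x2)) by (apply Rmult_le_pos; nra).
  assert (0 <= (1 + n) * (y2 * y2)) by (apply Rmult_le_pos; nra).
  nra.
Qed.

Lemma conjugate_sym (n x1 y1 x2 y2 : R) :
  conjugate n x1 y1 x2 y2 -> conjugate n x2 y2 x1 y1.
Proof. unfold conjugate. lra. Qed.

(** This is the squared length of ((1-n)x, (1+n)y), the normal of the line of points conjugate to
    (x, y). *)
Lemma conjugate_norm_pos (n x y : R) : 0 < n < 1 -> x ^ 2 + y ^ 2 = 1 ->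
  0 < (1 + n) ^ 2 - 4 * n * x ^ 2.
Proof. intros Hn H. pose proof (pow2_ge_0 y). nra. Qed.

(* The last two hypotheses say that [z1 z2 + z2 z3 + z3 z1 = - n] for [zj = xj + i yj]. *)
Inductive orbit (n g a b C S : R) : Defs.triangle -> Prop :=
  Orbit x1 y1 x2 y2 x3 y3 :
    x1 ^ 2 + y1 ^ 2 = 1 -> x2 ^ 2 + y2 ^ 2 = 1 -> x3 ^ 2 + y3 ^ 2 = 1 ->
    0 < chord x2 y2 x3 y3 -> 0 < chord x3 y3 x1 y1 -> 0 < chord x1 y1 x2 y2 ->
    distance (a * x2, b * y2) (a * x3, b * y3) = 2 * g * chord x2 y2 x3 y3 ->
    distance (a * x3, b * y3) (a * x1, b * y1) = 2 * g * chord x3 y3 x1 y1 ->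
    distance (a * x1, b * y1) (a * x2, b * y2) = 2 * g * chord x1 y1 x2 y2 ->
    C ^ 2 + S ^ 2 = 1 ->
    x1 + x2 + x3 = - n * C -> y1 + y2 + y3 = - n * S ->
    x2 * x3 + x3 * x1 + x1 * x2 - (y2 * y3 + y3 * y1 + y1 * y2) = - n ->
    x2 * y3 + x3 * y2 + (x3 * y1 + x1 * y3) + (x1 * y2 + x2 * y1) = 0 ->
    orbit n g a b C S (Triangle (a * x1, b * y1) (a * x2, b * y2) (a * x3, b * y3)).

(** Both points lie on the line, with normal (A, B), of conjugates of (x1, y1). Their sum is
    orthogonal to their difference, hence is twice the foot of the perpendicular from the origin;
    their complex product is (z2 + z3)^2 / |z2 + z3|^2. *)
Lemma conjugate_sums (n x1 y1 x2 y2 x3 y3 : R) : 0 < n < 1 ->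
  x1 ^ 2 + y1 ^ 2 = 1 -> x2 ^ 2 + y2 ^ 2 = 1 -> x3 ^ 2 + y3 ^ 2 = 1 ->
  conjugate n x1 y1 x2 y2 -> conjugate n x1 y1 x3 y3 -> (x2, y2) <> (x3, y3) ->
  let D := (1 + n) ^ 2 - 4 * n * x1 ^ 2 in
  D * (x2 + x3) = - (1 - n ^ 2) * (1 - n) * x1 /\
  D * (y2 + y3) = - (1 - n ^ 2) * (1 + n) * y1 /\
  D * (x2 * x3 - y2 * y3) = (1 - n) ^ 2 * x1 ^ 2 - (1 + n) ^ 2 * y1 ^ 2 /\
  D * (x2 * y3 + x3 * y2) = 2 * (1 - n ^ 2) * x1 * y1.
Proof.
  intros Hn H1 H2 H3 K2 K3 N D. unfold conjugate in K2, K3.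
  pose proof (conjugate_norm_pos n x1 y1 Hn H1) as HD. fold D in HD.
  set (A := (1 - n) * x1). set (B := (1 + n) * y1).
  assert (ED : D = A ^ 2 + B ^ 2).
  { unfold D, A, B. replace (((1 + n) * y1) ^ 2) with ((1 + n) ^ 2 * (1 - x1 ^ 2))
      by (rewrite <- H1; ring). ring. }
  set (p := x2 + x3). set (q := y2 + y3).
  assert (L : A * p + B * q = n ^ 2 - 1) by (unfold A, B, p, q; lra).
  assert (O1 : (x2 - x3) * A + (y2 - y3) * B = 0) by (unfold A, B; lra).
  assert (O2 : (x2 - x3) * p + (y2 - y3) * q = 0) by (unfold p, q; lra).
  assert (Par : A * q = B * p).
  { apply Rminus_diag_uniq.
    destruct (Req_dec (x2 - x3) 0) as [E|E].
    - apply Rmult_eq_reg_l with (y2 - y3); [|intros E'; apply N; f_equal; lra].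
      transitivity (A * ((x2 - x3) * p + (y2 - y3) * q)
                    - p * ((x2 - x3) * A + (y2 - y3) * B)); [ring|].
      rewrite O1, O2. ring.
    - apply Rmult_eq_reg_l with (x2 - x3); [|exact E].
      transitivity (q * ((x2 - x3) * A + (y2 - y3) * B)
                    - B * ((x2 - x3) * p + (y2 - y3) * q)); [ring|].
      rewrite O1, O2. ring. }
  assert (Ep : D * p = (n ^ 2 - 1) * A).
  { rewrite ED, <- L. transitivity (A ^ 2 * p + B * (B * p)); [ring|]. rewrite <- Par. ring. }
  assert (Eq : D * q = (n ^ 2 - 1) * B).
  { rewrite ED, <- L. transitivity (B ^ 2 * q + A * (A * q)); [ring|]. rewrite Par. ring. }
  assert (Epq : D * (p ^ 2 + q ^ 2) = (n ^ 2 - 1) ^ 2).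
  { apply Rmult_eq_reg_l with D; [|lra].
    transitivity ((D * p) ^ 2 + (D * q) ^ 2); [ring|]. rewrite Ep, Eq, ED. ring. }
  assert (M2 : y2 ^ 2 = 1 - x2 ^ 2) by lra. assert (M3 : y3 ^ 2 = 1 - x3 ^ 2) by lra.
  assert (R1 : (p ^ 2 + q ^ 2) * (x2 * x3 - y2 * y3) = p ^ 2 - q ^ 2).
  { unfold p, q.
    transitivity ((x2 ^ 2 + y2 ^ 2 + (x3 ^ 2 + y3 ^ 2)) * (x2 * x3 - y2 * y3)
      + 2 * (x2 ^ 2 * x3 ^ 2 - y2 ^ 2 * y3 ^ 2)); [ring|].
    rewrite H2, H3.
    transitivity (x2 ^ 2 + x3 ^ 2 - y2 ^ 2 - y3 ^ 2 + 2 * (x2 * x3 - y2 * y3)); [|ring].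
    rewrite M2, M3. ring. }
  assert (R2 : (p ^ 2 + q ^ 2) * (x2 * y3 + x3 * y2) = 2 * (p * q)).
  { unfold p, q.
    transitivity ((x2 ^ 2 + y2 ^ 2 + (x3 ^ 2 + y3 ^ 2)) * (x2 * y3 + x3 * y2)
      + 2 * ((x2 ^ 2 + y2 ^ 2) * (x3 * y3) + (x3 ^ 2 + y3 ^ 2) * (x2 * y2))); [ring|].
    rewrite H2, H3. ring. }
  assert (HN : 0 < (n ^ 2 - 1) ^ 2) by (apply pow2_gt_0; nra).
  repeat split.
  - rewrite Ep. unfold A. ring.
  - rewrite Eq. unfold B. ring.
  - apply Rmult_eq_reg_l with ((n ^ 2 - 1) ^ 2); [|lra].
    transitivity (D * (D * ((p ^ 2 + q ^ 2) * (x2 * x3 - y2 * y3)))); [rewrite <- Epq; ring|].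
    rewrite R1. transitivity ((D * p) ^ 2 - (D * q) ^ 2); [ring|].
    rewrite Ep, Eq. unfold A, B. ring.
  - apply Rmult_eq_reg_l with ((n ^ 2 - 1) ^ 2); [|lra].
    transitivity (D * (D * ((p ^ 2 + q ^ 2) * (x2 * y3 + x3 * y2)))); [rewrite <- Epq; ring|].
    rewrite R2. transitivity (2 * ((D * p) * (D * q))); [ring|].
    rewrite Ep, Eq. unfold A, B. ring.
Qed.

(** The standing hypothesis: shape n and scale g as delivered by [confocal_parameters]. *)
Definition setting (n g a b : R) : Prop :=
  0 < n < 1 /\ 0 < g /\ 0 < a /\ 0 < b /\
  a ^ 2 = g ^ 2 * (1 + n) * (3 - n) /\ b ^ 2 = g ^ 2 * (1 - n) * (3 + n) /\
  caustic_x a b = a * ((1 + n) / 2) /\ caustic_y a b = b * ((1 - n) / 2).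

Lemma on_ellipse_unit (a b x y : R) : 0 < a -> 0 < b ->
  on_ellipse a b (a * x, b * y) <-> x ^ 2 + y ^ 2 = 1.
Proof.
  intros Ha Hb. unfold on_ellipse; simpl fst; simpl snd.
  replace ((a * x) ^ 2 / a ^ 2 + (b * y) ^ 2 / b ^ 2) with (x ^ 2 + y ^ 2); [tauto|].
  field. lra.
Qed.

Lemma poncelet_conjugate (n g a b x1 y1 x2 y2 x3 y3 : R) : setting n g a b ->
  poncelet a b (Triangle (a * x1, b * y1) (a * x2, b * y2) (a * x3, b * y3)) <->
  (x1 ^ 2 + y1 ^ 2 = 1 /\ x2 ^ 2 + y2 ^ 2 = 1 /\ x3 ^ 2 + y3 ^ 2 = 1) /\
  conjugate n x2 y2 x3 y3 /\ conjugate n x3 y3 x1 y1 /\ conjugate n x1 y1 x2 y2.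
Proof.
  intros (Hn & Hg & Ha & Hb & _ & _ & Hx & Hy).
  unfold poncelet, V1, V2, V3. rewrite !on_ellipse_unit by assumption. rewrite Hx, Hy.
  split; intros [(H1 & H2 & H3) (T1 & T2 & T3)]; (split; [tauto|]).
  - apply tangent_line_conjugate in T1, T2, T3; tauto.
  - rewrite !tangent_line_conjugate by assumption.
    pose proof (conjugate_neq n _ _ _ _ Hn T1). pose proof (conjugate_neq n _ _ _ _ Hn T2).
    pose proof (conjugate_neq n _ _ _ _ Hn T3). tauto.
Qed.

(** C and S are chosen so that z1 + z2 + z3 = - n l. As [conjugate_sums] gives D(z2 + z3) and D z2
    z3 in terms of z1, the other vertex relations become polynomial identities in the first vertex
    once D is cleared. *)
Lemma poncelet_orbit_at (n g a b x1 y1 x2 y2 x3 y3 : R) : setting n g a b ->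
  let T := Triangle (a * x1, b * y1) (a * x2, b * y2) (a * x3, b * y3) in
  poncelet a b T -> orbit n g a b (- (x1 + x2 + x3) / n) (- (y1 + y2 + y3) / n) T.
Proof.
  intros HS T HT. apply (poncelet_conjugate n g) in HT; [|exact HS].
  destruct HT as [(H1 & H2 & H3) (K1 & K2 & K3)].
  destruct HS as (Hn & Hg & Ha & Hb & Ea & Eb & _ & _).
  pose proof (chord_pos _ _ _ _ H2 H3 (conjugate_neq n _ _ _ _ Hn K1)) as P1.
  pose proof (chord_pos _ _ _ _ H3 H1 (conjugate_neq n _ _ _ _ Hn K2)) as P2.
  pose proof (chord_pos _ _ _ _ H1 H2 (conjugate_neq n _ _ _ _ Hn K3)) as P3.
  destruct (conjugate_sums n x1 y1 x2 y2 x3 y3) as (E1 & E2 & E3 & E4); auto using conjugate_sym.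
  { apply (conjugate_neq n); assumption. }
  pose proof (conjugate_norm_pos n x1 y1 Hn H1) as HD.
  set (D := (1 + n) ^ 2 - 4 * n * x1 ^ 2) in *.
  assert (M1 : y1 ^ 2 = 1 - x1 ^ 2) by lra.
  apply Orbit; try assumption.
  1, 2, 3: apply (distance_chord n); assumption.
  - apply Rmult_eq_reg_l with (D ^ 2 * n ^ 2);
      [|apply Rgt_not_eq, Rmult_lt_0_compat; apply pow_lt; lra].
    transitivity ((D * x1 + D * (x2 + x3)) ^ 2 + (D * y1 + D * (y2 + y3)) ^ 2); [field; lra|].
    rewrite E1, E2.
    transitivity (x1 ^ 2 * (D - (1 - n ^ 2) * (1 - n)) ^ 2
                  + y1 ^ 2 * (D - (1 - n ^ 2) * (1 + n)) ^ 2); [ring|].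
    rewrite M1. unfold D. ring.
  - field. lra.
  - field. lra.
  - apply Rmult_eq_reg_l with D; [|lra].
    transitivity (x1 * (D * (x2 + x3)) - y1 * (D * (y2 + y3)) + D * (x2 * x3 - y2 * y3)); [ring|].
    rewrite E1, E2, E3.
    transitivity (- (1 - n ^ 2) * (1 - n) * x1 ^ 2 + (1 - n ^ 2) * (1 + n) * y1 ^ 2
      + ((1 - n) ^ 2 * x1 ^ 2 - (1 + n) ^ 2 * y1 ^ 2)); [ring|].
    rewrite M1. unfold D. ring.
  - apply Rmult_eq_reg_l with D; [|lra].
    transitivity (x1 * (D * (y2 + y3)) + y1 * (D * (x2 + x3)) + D * (x2 * y3 + x3 * y2)); [ring|].
    rewrite E1, E2, E4. ring.
Qed.

Lemma poncelet_orbit (n g a b : R) (T : Defs.triangle) : setting n g a b ->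
  poncelet a b T -> exists C S, orbit n g a b C S T.
Proof.
  intros HS. assert (Ha : 0 < a) by apply HS. assert (Hb : 0 < b) by apply HS.
  assert (E : forall P, exists x y, P = (a * x, b * y)).
  { intros [x y]. exists (x / a), (y / b). f_equal; field; lra. }
  destruct T as [P Q W].
  destruct (E P) as (x1 & y1 & ->), (E Q) as (x2 & y2 & ->), (E W) as (x3 & y3 & ->).
  intros HT. eexists; eexists. apply poncelet_orbit_at; eassumption.
Qed.

(** The line of conjugates of (x1, y1) cuts the unit circle in two points, obtained by shifting the
    foot (k/D)(A, B) by h(-B, A) either way. *)
Lemma conjugate_pair_exists (n x1 y1 : R) : 0 < n < 1 -> x1 ^ 2 + y1 ^ 2 = 1 ->
  exists x2 y2 x3 y3, (x2 ^ 2 + y2 ^ 2 = 1 /\ x3 ^ 2 + y3 ^ 2 = 1) /\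
    conjugate n x2 y2 x3 y3 /\ conjugate n x3 y3 x1 y1 /\ conjugate n x1 y1 x2 y2.
Proof.
  intros Hn H1.
  pose proof (conjugate_norm_pos n x1 y1 Hn H1) as HD.
  set (D := (1 + n) ^ 2 - 4 * n * x1 ^ 2) in *.
  assert (M1 : y1 ^ 2 = 1 - x1 ^ 2) by lra.
  set (A := (1 - n) * x1). set (B := (1 + n) * y1). set (k := (n ^ 2 - 1) / 2).
  assert (ED : A ^ 2 + B ^ 2 = D).
  { unfold D, A, B. transitivity ((1 - n) ^ 2 * x1 ^ 2 + (1 + n) ^ 2 * y1 ^ 2); [ring|].
    rewrite M1. ring. }
  (* The line meets the circle, since k^2 < (1 - n)^2 <= D. *)
  assert (Hk : k ^ 2 < D).
  { assert (x1 ^ 2 <= 1) by (pose proof (pow2_ge_0 y1); lra).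
    assert (k ^ 2 = ((1 - n) * ((1 + n) / 2)) ^ 2) by (unfold k; field).
    assert ((1 - n) * ((1 + n) / 2) < 1 - n) by nra.
    assert (0 < (1 - n) * ((1 + n) / 2)) by nra.
    assert (k ^ 2 < (1 - n) ^ 2) by nra.
    unfold D. nra. }
  set (h := sqrt ((D - k ^ 2) / D ^ 2)).
  assert (Hh : h ^ 2 = (D - k ^ 2) / D ^ 2).
  { unfold h. apply pow2_sqrt, Rlt_le, Rdiv_lt_0_compat; [lra | apply pow_lt; lra]. }
  exists (k * A / D - h * B), (k * B / D + h * A), (k * A / D + h * B), (k * B / D - h * A).
  assert (U : (k ^ 2 / D ^ 2 + h ^ 2) * (A ^ 2 + B ^ 2) = 1).
  { rewrite Hh, ED. field. lra. }
  assert (L : A * (k * A / D) + B * (k * B / D) = k).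
  { transitivity (k * (A ^ 2 + B ^ 2) / D); [field; lra|]. rewrite ED. field. lra. }
  repeat split; unfold conjugate.
  - rewrite <- U. field. lra.
  - rewrite <- U. field. lra.
  (* Poncelet closure: the two intersection points are conjugate to each other, an identity in x1
     once h^2, D and k are inserted. *)
  - transitivity (2 * (1 - n) * (k ^ 2 / D ^ 2 * A ^ 2 - h ^ 2 * B ^ 2)
      + 2 * (1 + n) * (k ^ 2 / D ^ 2 * B ^ 2 - h ^ 2 * A ^ 2)); [field; lra|].
    rewrite Hh.
    replace (A ^ 2) with (D - B ^ 2) by lra.
    transitivity ((2 * (1 - n) * (k ^ 2 - B ^ 2) + 2 * (1 + n) * (k ^ 2 - (D - B ^ 2))) / D);
      [field; lra|].
    replace (B ^ 2) with ((1 + n) ^ 2 * (1 - x1 ^ 2)) by (unfold B; rewrite <- M1; ring).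
    apply Rmult_eq_reg_r with D; [|lra].
    unfold Rdiv. rewrite Rmult_assoc, Rinv_l by lra. unfold k, D. field.
  - transitivity (2 * (A * (k * A / D) + B * (k * B / D)) );
      [unfold A, B; field; lra|]. rewrite L. unfold k. field.
  - transitivity (2 * (A * (k * A / D) + B * (k * B / D)) );
      [unfold A, B; field; lra|]. rewrite L. unfold k. field.
Qed.

(** A first vertex is sought whose triangle has vertex sum - n (C, S). The intermediate value
    theorem gives its abscissa, which fixes the ordinate up to sign. *)
Lemma orbit_exists (n g a b C S : R) : setting n g a b -> C ^ 2 + S ^ 2 = 1 ->
  exists T, poncelet a b T /\ orbit n g a b C S T.
Proof.
  intros HS HC. assert (Hn : 0 < n < 1) by apply HS.
  set (D := fun x => (1 + n) ^ 2 - 4 * n * x ^ 2).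
  (* By [conjugate_sums], f x is D x times the excess of the sum of the abscissas over - n C. *)
  set (f := fun x => x * (D x - (1 - n ^ 2) * (1 - n)) + n * C * D x).
  assert (HC1 : -1 <= C <= 1) by nra.
  destruct (IVT_cor f (-1) 1) as [x [Hx Hf]].
  { unfold f, D. reg. }
  { lra. }
  { assert (E1 : f 1 = - (n * (1 - n) ^ 2 * (1 - C))) by (unfold f, D; ring).
    assert (E2 : f (-1) = n * (1 - n) ^ 2 * (1 + C)) by (unfold f, D; ring).
    rewrite E1, E2.
    assert (0 <= n * (1 - n) ^ 2) by (apply Rmult_le_pos; [lra | apply pow2_ge_0]).
    assert (0 <= n * (1 - n) ^ 2 * (1 - C)) by (apply Rmult_le_pos; lra).
    assert (0 <= n * (1 - n) ^ 2 * (1 + C)) by (apply Rmult_le_pos; lra).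
    nra. }
  assert (Hs : 0 <= 1 - x ^ 2) by nra.
  set (r := sqrt (1 - x ^ 2)).
  assert (Hr : r ^ 2 = 1 - x ^ 2) by (apply pow2_sqrt; exact Hs).
  assert (HDx : 0 < D x) by (apply (conjugate_norm_pos n x r); lra).
  set (G := D x - (1 - n ^ 2) * (1 + n)).
  assert (Hy : exists y, y ^ 2 = 1 - x ^ 2 /\ y * G + n * S * D x = 0).
  (* The vertex sum has length n, so C^2 + S^2 = 1 gives the equation for the ordinates up to sign;
     the sign of y is chosen to match. *)
  { assert (E : (r * G - n * S * D x) * (r * G + n * S * D x) = 0).
    { transitivity (r ^ 2 * G ^ 2 - n ^ 2 * S ^ 2 * D x ^ 2); [ring|].
      replace (S ^ 2) with (1 - C ^ 2) by lra. rewrite Hr.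
      transitivity ((1 - x ^ 2) * G ^ 2 - n ^ 2 * D x ^ 2 + (n * C * D x) ^ 2); [ring|].
      replace (n * C * D x) with (- (x * (D x - (1 - n ^ 2) * (1 - n)))) by (unfold f in Hf; lra).
      unfold G, D. ring. }
    apply Rmult_integral in E. destruct E as [E|E].
    - exists (- r). split; [rewrite <- Hr; ring | lra].
    - exists r. split; [exact Hr | lra]. }
  destruct Hy as (y & Hy & HG).
  assert (H1 : x ^ 2 + y ^ 2 = 1) by lra.
  destruct (conjugate_pair_exists n x y Hn H1) as (x2 & y2 & x3 & y3 & (H2 & H3) & K1 & K2 & K3).
  exists (Triangle (a * x, b * y) (a * x2, b * y2) (a * x3, b * y3)).
  assert (HT : poncelet a b (Triangle (a * x, b * y) (a * x2, b * y2) (a * x3, b * y3)))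
    by (apply (poncelet_conjugate n g); tauto).
  split; [exact HT|].
  destruct (conjugate_sums n x y x2 y2 x3 y3) as (E1 & E2 & _); auto using conjugate_sym.
  { apply (conjugate_neq n); assumption. }
  fold (D x) in E1, E2.
  replace C with (- (x + x2 + x3) / n); [replace S with (- (y + y2 + y3) / n)|].
  - apply poncelet_orbit_at; assumption.
  - apply Rmult_eq_reg_r with (n * D x); [|nra].
    transitivity (- (D x * y + D x * (y2 + y3))); [field; lra|]. rewrite E2. unfold G in HG. lra.
  - apply Rmult_eq_reg_r with (n * D x); [|nra].
    transitivity (- (D x * x + D x * (x2 + x3))); [field; lra|]. rewrite E1. unfold f in Hf. lra.
Qed.

(** * Symmetric functions of the sidelengths *)

(** Three vectors in the plane have vanishing Gram determinant; it is rewritten in x = 1 - u2.u3 and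
    its analogues. *)
Lemma chord_gram (x1 y1 x2 y2 x3 y3 : R) :
  x1 ^ 2 + y1 ^ 2 = 1 -> x2 ^ 2 + y2 ^ 2 = 1 -> x3 ^ 2 + y3 ^ 2 = 1 ->
  let x := chord x2 y2 x3 y3 in
  let y := chord x3 y3 x1 y1 in
  let z := chord x1 y1 x2 y2 in
  4 * (x * y + y * z + z * x) - (x + y + z) ^ 2 = 2 * (x * y * z).
Proof.
  intros H1 H2 H3 x y z.
  set (d1 := x2 * x3 + y2 * y3). set (d2 := x3 * x1 + y3 * y1). set (d3 := x1 * x2 + y1 * y2).
  assert (G : (x1 ^ 2 + y1 ^ 2) * (x2 ^ 2 + y2 ^ 2) * (x3 ^ 2 + y3 ^ 2) + 2 * (d1 * d2 * d3)
    = (x1 ^ 2 + y1 ^ 2) * d1 ^ 2 + (x2 ^ 2 + y2 ^ 2) * d2 ^ 2 + (x3 ^ 2 + y3 ^ 2) * d3 ^ 2)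
    by (unfold d1, d2, d3; ring).
  rewrite H1, H2, H3 in G.
  assert (Ex : x = 1 - d1) by (unfold x, chord, d1; ring).
  assert (Ey : y = 1 - d2) by (unfold y, chord, d2; ring).
  assert (Ez : z = 1 - d3) by (unfold z, chord, d3; ring).
  rewrite Ex, Ey, Ez. lra.
Qed.

(* The vector with these two coordinates has zero inner product with each of the three unit
   vectors, hence with itself. *)
Lemma mittenpunkt_origin (x1 y1 x2 y2 x3 y3 : R) :
  x1 ^ 2 + y1 ^ 2 = 1 -> x2 ^ 2 + y2 ^ 2 = 1 -> x3 ^ 2 + y3 ^ 2 = 1 ->
  let x := chord x2 y2 x3 y3 in
  let y := chord x3 y3 x1 y1 in
  let z := chord x1 y1 x2 y2 in
  x * (y + z - x) * x1 + y * (z + x - y) * x2 + z * (x + y - z) * x3 = 0 /\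
  x * (y + z - x) * y1 + y * (z + x - y) * y2 + z * (x + y - z) * y3 = 0.
Proof.
  intros H1 H2 H3 x y z.
  pose proof (chord_gram x1 y1 x2 y2 x3 y3 H1 H2 H3) as G. fold x y z in G. cbv zeta in G.
  set (c1 := x * (y + z - x)). set (c2 := y * (z + x - y)). set (c3 := z * (x + y - z)).
  set (p := c1 * x1 + c2 * x2 + c3 * x3). set (q := c1 * y1 + c2 * y2 + c3 * y3).
  (* Both c1 + c2 + c3, by the Gram relation, and c2 z + c3 y, identically, equal 2xyz. *)
  assert (O1 : p * x1 + q * y1 = 0).
  { transitivity (c1 * (x1 ^ 2 + y1 ^ 2) + c2 * (1 - z) + c3 * (1 - y));
      [unfold p, q, y, z, chord; ring|]. rewrite H1. unfold c1, c2, c3. lra. }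
  assert (O2 : p * x2 + q * y2 = 0).
  { transitivity (c1 * (1 - z) + c2 * (x2 ^ 2 + y2 ^ 2) + c3 * (1 - x));
      [unfold p, q, x, z, chord; ring|]. rewrite H2. unfold c1, c2, c3. lra. }
  assert (O3 : p * x3 + q * y3 = 0).
  { transitivity (c1 * (1 - y) + c2 * (1 - x) + c3 * (x3 ^ 2 + y3 ^ 2));
      [unfold p, q, x, y, chord; ring|]. rewrite H3. unfold c1, c2, c3. lra. }
  assert (O : p ^ 2 + q ^ 2 = 0).
  { transitivity (c1 * (p * x1 + q * y1) + c2 * (p * x2 + q * y2) + c3 * (p * x3 + q * y3));
      [unfold p, q; ring|]. rewrite O1, O2, O3. ring. }
  pose proof (pow2_ge_0 p). pose proof (pow2_ge_0 q).
  split; apply Rsqr_0_uniq; rewrite Rsqr_pow2; lra.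
Qed.

(** In units of 2g; being free of C and S, it is common to the whole family. *)
Definition perimeter (n : R) : R := (9 - n ^ 2) / 2.

(** Let s1, s2 be the sum and the sum of pairwise products of the complex vertices. Then |s1| = n
    gives the perimeter; the squared modulus of z1^2 + z2^2 + z3^2 = s1^2 - 2 s2 gives x^2 + y^2 +
    z^2, hence xyz by the Gram relation; and x z1 + y z2 + z z3 = 3 s1 - s2 conj(s1). *)
Lemma orbit_sums (n C S x1 y1 x2 y2 x3 y3 : R) :
  x1 ^ 2 + y1 ^ 2 = 1 -> x2 ^ 2 + y2 ^ 2 = 1 -> x3 ^ 2 + y3 ^ 2 = 1 ->
  C ^ 2 + S ^ 2 = 1 ->
  x1 + x2 + x3 = - n * C -> y1 + y2 + y3 = - n * S ->
  x2 * x3 + x3 * x1 + x1 * x2 - (y2 * y3 + y3 * y1 + y1 * y2) = - n ->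
  x2 * y3 + x3 * y2 + (x3 * y1 + x1 * y3) + (x1 * y2 + x2 * y1) = 0 ->
  let x := chord x2 y2 x3 y3 in
  let y := chord x3 y3 x1 y1 in
  let z := chord x1 y1 x2 y2 in
  x + y + z = perimeter n /\
  x * y * z = (27 - 18 * n ^ 2 + 8 * n ^ 3 - n ^ 4 - 16 * n ^ 3 * C ^ 2) / 8 /\
  x * x1 + y * x2 + z * x3 = - n * C * (3 + n) /\
  x * y1 + y * y2 + z * y3 = - n * S * (3 - n).
Proof.
  intros H1 H2 H3 HC Sx Sy Pr Pi x y z.
  assert (Ep : x + y + z = perimeter n).
  { assert ((x1 + x2 + x3) ^ 2 + (y1 + y2 + y3) ^ 2 = n ^ 2).
    { rewrite Sx, Sy. transitivity (n ^ 2 * (C ^ 2 + S ^ 2)); [ring|]. rewrite HC. ring. }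
    unfold x, y, z, chord, perimeter. lra. }
  split; [exact Ep|split; [|split]].
  - pose proof (chord_gram x1 y1 x2 y2 x3 y3 H1 H2 H3) as G. fold x y z in G. cbv zeta in G.
    rewrite Ep in G.
    (* Real and imaginary parts of z1^2 + z2^2 + z3^2. *)
    set (re := x1 ^ 2 - y1 ^ 2 + (x2 ^ 2 - y2 ^ 2) + (x3 ^ 2 - y3 ^ 2)).
    set (im := 2 * (x1 * y1 + x2 * y2 + x3 * y3)).
    assert (Ere : re = n ^ 2 * (C ^ 2 - S ^ 2) + 2 * n).
    { transitivity ((x1 + x2 + x3) ^ 2 - (y1 + y2 + y3) ^ 2
        - 2 * (x2 * x3 + x3 * x1 + x1 * x2 - (y2 * y3 + y3 * y1 + y1 * y2)));
        [unfold re; ring|]. rewrite Sx, Sy, Pr. ring. }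
    assert (Eim : im = 2 * n ^ 2 * (C * S)).
    { transitivity (2 * ((x1 + x2 + x3) * (y1 + y2 + y3))
        - 2 * (x2 * y3 + x3 * y2 + (x3 * y1 + x1 * y3) + (x1 * y2 + x2 * y1)));
        [unfold im; ring|]. rewrite Sx, Sy, Pi. ring. }
    assert (Esq : re ^ 2 + im ^ 2 = n ^ 4 + 4 * n ^ 2 + 4 * n ^ 3 * (2 * C ^ 2 - 1)).
    { rewrite Ere, Eim.
      transitivity (n ^ 4 * (C ^ 2 + S ^ 2) ^ 2 + 4 * n ^ 3 * (C ^ 2 - S ^ 2) + 4 * n ^ 2);
          [ring|].
      replace (C ^ 2 - S ^ 2) with (2 * C ^ 2 - 1) by lra. rewrite HC. ring. }
    assert (Esq' : re ^ 2 + im ^ 2 = 4 * ((1 - x) ^ 2 + (1 - y) ^ 2 + (1 - z) ^ 2) - 3).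
    { transitivity ((x1 ^ 2 + y1 ^ 2) ^ 2 + (x2 ^ 2 + y2 ^ 2) ^ 2 + (x3 ^ 2 + y3 ^ 2) ^ 2
        + 4 * ((1 - x) ^ 2 + (1 - y) ^ 2 + (1 - z) ^ 2)
        - 2 * ((x2 ^ 2 + y2 ^ 2) * (x3 ^ 2 + y3 ^ 2) + (x3 ^ 2 + y3 ^ 2) * (x1 ^ 2 + y1 ^ 2)
               + (x1 ^ 2 + y1 ^ 2) * (x2 ^ 2 + y2 ^ 2))).
      - unfold re, im, x, y, z, chord. ring.
      - rewrite H1, H2, H3. ring. }
    assert (E2 : x ^ 2 + y ^ 2 + z ^ 2 + 2 * (x * y + y * z + z * x) = perimeter n ^ 2)
      by (rewrite <- Ep; ring).
    rewrite Esq in Esq'. unfold perimeter in *. lra.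
  - transitivity (x1 + x2 + x3 - ((x2 * x3 + x3 * x1 + x1 * x2 - (y2 * y3 + y3 * y1 + y1 * y2))
        * (x1 + x2 + x3)
      + (x2 * y3 + x3 * y2 + (x3 * y1 + x1 * y3) + (x1 * y2 + x2 * y1)) * (y1 + y2 + y3)
      - (x1 ^ 2 + y1 ^ 2) * (x2 + x3) - (x2 ^ 2 + y2 ^ 2) * (x3 + x1)
      - (x3 ^ 2 + y3 ^ 2) * (x1 + x2))).
    + unfold x, y, z, chord. ring.
    + rewrite H1, H2, H3, Pr, Pi.
      transitivity ((3 + n) * (x1 + x2 + x3)); [ring|]. rewrite Sx. ring.
  - transitivity (y1 + y2 + y3 - ((x2 * y3 + x3 * y2 + (x3 * y1 + x1 * y3) + (x1 * y2 + x2 * y1))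
        * (x1 + x2 + x3)
      - (x2 * x3 + x3 * x1 + x1 * x2 - (y2 * y3 + y3 * y1 + y1 * y2)) * (y1 + y2 + y3)
      - (x1 ^ 2 + y1 ^ 2) * (y2 + y3) - (x2 ^ 2 + y2 ^ 2) * (y3 + y1)
      - (x3 ^ 2 + y3 ^ 2) * (y1 + y2))).
    + unfold x, y, z, chord. ring.
    + rewrite H1, H2, H3, Pr, Pi.
      transitivity ((3 - n) * (y1 + y2 + y3)); [ring|]. rewrite Sy. ring.
Qed.

(** * Loci of barycentric centers *)

(** A coefficient takes the elementary symmetric functions e1, e2, e3 of the sidelengths as
    arguments. *)
Record quadratic := Quadratic { coef0 : R -> R -> R -> R; coef1 : R -> R -> R -> R;
    coef2 : R -> R -> R -> R }.

(* Modulo the cubic with roots [x], [y], [z], a weight symmetric in [y] and [z] is a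
   quadratic polynomial in [x] whose coefficients are symmetric in [x], [y], [z]. *)
Definition reduces (h : R -> R -> R -> R) (mu : R -> R -> R) (r : quadratic) : Prop :=
  forall c x y z, 0 < c -> 0 < x -> 0 < y -> 0 < z ->
  let e1 := x + y + z in
  let e2 := x * y + y * z + z * x in
  let e3 := x * y * z in
  h (c * x) (c * y) (c * z) =
    mu c e3 * (coef0 r e1 e2 e3 + coef1 r e1 e2 e3 * x + coef2 r e1 e2 e3 * x ^ 2).

(* Here [e] is the product of the normalised sidelengths; [chord_gram] determines [e2] from it. *)
Definition total (r : quadratic) (n e : R) : R :=
  let e1 := perimeter n in
  let e2 := e / 2 + e1 ^ 2 / 4 in
  3 * coef0 r e1 e2 e + coef1 r e1 e2 e * e1 + coef2 r e1 e2 e * (e1 ^ 2 - 2 * e2).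

(** The abscissa of the weighted vertex sum on the unit circle, divided by C; for the ordinate, n
    becomes - n and the sign changes. *)
Definition moment (r : quadratic) (n e : R) : R :=
  let e1 := perimeter n in
  let e2 := e / 2 + e1 ^ 2 / 4 in
  - n * (coef0 r e1 e2 e + (coef1 r e1 e2 e + coef2 r e1 e2 e * e1 / 2) * (3 + n)).

Definition sides_product (n C : R) : R :=
  (27 - 18 * n ^ 2 + 8 * n ^ 3 - n ^ 4 - 16 * n ^ 3 * C ^ 2) / 8.

(** Weights 1 and t are covered by [orbit_sums]. The weight t^2 is half of e1 t - t (e1 - 2t), and
    the subtracted mittenpunkt weight contributes nothing. *)
Lemma orbit_weighted_sums (n C S x1 y1 x2 y2 x3 y3 : R) (r : quadratic) :
  x1 ^ 2 + y1 ^ 2 = 1 -> x2 ^ 2 + y2 ^ 2 = 1 -> x3 ^ 2 + y3 ^ 2 = 1 ->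
  C ^ 2 + S ^ 2 = 1 ->
  x1 + x2 + x3 = - n * C -> y1 + y2 + y3 = - n * S ->
  x2 * x3 + x3 * x1 + x1 * x2 - (y2 * y3 + y3 * y1 + y1 * y2) = - n ->
  x2 * y3 + x3 * y2 + (x3 * y1 + x1 * y3) + (x1 * y2 + x2 * y1) = 0 ->
  let x := chord x2 y2 x3 y3 in
  let y := chord x3 y3 x1 y1 in
  let z := chord x1 y1 x2 y2 in
  let e1 := x + y + z in
  let e2 := x * y + y * z + z * x in
  let e3 := x * y * z in
  let w t := coef0 r e1 e2 e3 + coef1 r e1 e2 e3 * t + coef2 r e1 e2 e3 * t ^ 2 in
  e3 = sides_product n C /\
  w x + w y + w z = total r n e3 /\
  w x * x1 + w y * x2 + w z * x3 = C * moment r n e3 /\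
  w x * y1 + w y * y2 + w z * y3 = - (S * moment r (- n) e3).
Proof.
  intros H1 H2 H3 HC Sx Sy Pr Pi x y z e1 e2 e3 w.
  destruct (orbit_sums n C S x1 y1 x2 y2 x3 y3 H1 H2 H3 HC Sx Sy Pr Pi) as (Ep & Ev & Lx & Ly).
  pose proof (chord_gram x1 y1 x2 y2 x3 y3 H1 H2 H3) as G.
  pose proof (mittenpunkt_origin x1 y1 x2 y2 x3 y3 H1 H2 H3) as [Mx My].
  fold x y z in Ep, Ev, Lx, Ly, G, Mx, My. cbv zeta in Ep, Ev, Lx, Ly, G, Mx, My.
  assert (P1 : perimeter n = e1) by (unfold e1; lra).
  assert (P1' : perimeter (- n) = e1) by (rewrite <- P1; unfold perimeter; field).
  assert (P2 : e3 / 2 + e1 ^ 2 / 4 = e2) by (unfold e1, e2, e3; lra).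
  unfold total, moment. rewrite P1', P1, P2.
  split; [exact Ev|]. unfold w.
  set (a0 := coef0 r e1 e2 e3). set (a1 := coef1 r e1 e2 e3). set (a2 := coef2 r e1 e2 e3).
  split; [unfold e1, e2; ring|split].
  - transitivity (a0 * (x1 + x2 + x3) + (a1 + a2 * e1 / 2) * (x * x1 + y * x2 + z * x3)
      - a2 / 2 * (x * (y + z - x) * x1 + y * (z + x - y) * x2 + z * (x + y - z) * x3));
      [unfold e1; field|]. rewrite Mx, Lx, Sx. ring.
  - transitivity (a0 * (y1 + y2 + y3) + (a1 + a2 * e1 / 2) * (x * y1 + y * y2 + z * y3)
      - a2 / 2 * (x * (y + z - x) * y1 + y * (z + x - y) * y2 + z * (x + y - z) * y3));
      [unfold e1; field|]. rewrite My, Ly, Sy. ring.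
Qed.

(** The factor mu depends only on the scale c and on e3, so it is common to all three weights and
    drops out of homogeneous coordinates. *)
Lemma reduces_rotations (h : R -> R -> R -> R) mu r c x y z : reduces h mu r ->
  0 < c -> 0 < x -> 0 < y -> 0 < z ->
  let e1 := x + y + z in
  let e2 := x * y + y * z + z * x in
  let e3 := x * y * z in
  let w t := coef0 r e1 e2 e3 + coef1 r e1 e2 e3 * t + coef2 r e1 e2 e3 * t ^ 2 in
  h (c * x) (c * y) (c * z) = mu c e3 * w x /\
  h (c * y) (c * z) (c * x) = mu c e3 * w y /\
  h (c * z) (c * x) (c * y) = mu c e3 * w z.
Proof.
  intros Hr Hc Hx Hy Hz e1 e2 e3 w. unfold w.
  split; [apply Hr; assumption|split].
  - pose proof (Hr c y z x Hc Hy Hz Hx) as E. cbv zeta in E.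
    replace (y + z + x) with e1 in E by (unfold e1; ring).
    replace (y * z + z * x + x * y) with e2 in E by (unfold e2; ring).
    replace (y * z * x) with e3 in E by (unfold e3; ring). exact E.
  - pose proof (Hr c z x y Hc Hz Hx Hy) as E. cbv zeta in E.
    replace (z + x + y) with e1 in E by (unfold e1; ring).
    replace (z * x + x * y + y * z) with e2 in E by (unfold e2; ring).
    replace (z * x * y) with e3 in E by (unfold e3; ring). exact E.
Qed.

Lemma orbit_barycentric n g a b C S T h mu r : setting n g a b -> reduces h mu r ->
  (forall c e, 0 < c -> 0 < e -> mu c e <> 0) -> orbit n g a b C S T ->
  let e := sides_product n C in
  0 < e /\ forall M, barycentric h T M <-> total r n e <> 0 /\
    M = (a * (C * moment r n e / total r n e), b * (- (S * moment r (- n) e) / total r n e)).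
Proof.
  intros HS Hr Hmu HT e. assert (Hg : 0 < 2 * g) by (destruct HS as (_ & ? & _); lra).
  destruct HT as [x1 y1 x2 y2 x3 y3 H1 H2 H3 Hx Hy Hz D1 D2 D3 HC Sx Sy Pr Pi].
  destruct (orbit_weighted_sums n C S x1 y1 x2 y2 x3 y3 r H1 H2 H3 HC Sx Sy Pr Pi)
    as (Ee & W & Wx & Wy).
  destruct (reduces_rotations h mu r (2 * g) _ _ _ Hr Hg Hx Hy Hz) as (R1 & R2 & R3).
  cbv zeta in *. unfold barycentric, V1, V2, V3. rewrite D1, D2, D3, R1, R2, R3.
  rewrite Ee in *. fold e in Ee, W, Wx, Wy |- *.
  set (x := chord x2 y2 x3 y3) in *. set (y := chord x3 y3 x1 y1) in *.
  set (z := chord x1 y1 x2 y2) in *.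
  assert (He : 0 < e)
    by (rewrite <- Ee; apply Rmult_lt_0_compat; [apply Rmult_lt_0_compat|]; assumption).
  split; [exact He|]. pose proof (Hmu (2 * g) e Hg He) as Hm.
  set (m := mu (2 * g) e) in *.
  set (w1 := coef0 r _ _ _ + _ * x + _) in *. set (w2 := coef0 r _ _ _ + _ * y + _) in *.
  set (w3 := coef0 r _ _ _ + _ * z + _) in *.
  intros M. simpl fst; simpl snd. rewrite <- Wx, <- Wy, <- W.
  replace (m * w1 + m * w2 + m * w3) with (m * (w1 + w2 + w3)) by ring.
  split.
  - intros [N E].
    assert (N' : w1 + w2 + w3 <> 0) by (intros Z; apply N; rewrite Z; ring).
    split; [exact N'|]. rewrite E. f_equal; field; tauto.
  - intros [N E]. split; [apply Rmult_integral_contrapositive_currified; assumption|].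
    rewrite E. f_equal; field; tauto.
Qed.

(* One function [f] describes both axes: up to sign, exchanging them amounts to [n -> - n]. *)
Definition glides (n g a b : R) (F : center) (f : R -> R) : Prop :=
  forall C S T, orbit n g a b C S T ->
  forall M, F T M <-> M = (a * (f n * C), b * (- f (- n) * S)).

(** The value m = n serves the X-axis and m = - n the Y-axis; [total] is even in n, hence common to
    both. Since f does not involve e, the position is linear in (C, S). *)
Lemma glides_barycentric n g a b h mu r f : setting n g a b -> reduces h mu r ->
  (forall c e, 0 < c -> 0 < e -> mu c e <> 0) ->
  (forall m e, m ^ 2 = n ^ 2 -> 0 < e -> total r m e <> 0 /\ moment r m e = f m * total r m e) ->
  glides n g a b (barycentric h) f.
Proof.
  intros HS Hr Hmu Hf C S T HT M.
  destruct (orbit_barycentric n g a b C S T h mu r HS Hr Hmu HT) as [He HM].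
  rewrite HM. set (e := sides_product n C) in *.
  destruct (Hf n e eq_refl He) as [N E].
  destruct (Hf (- n) e) as [_ E']; [ring | exact He |].
  replace (total r (- n) e) with (total r n e) in E'
    by (unfold total; replace (perimeter (- n)) with (perimeter n) by (unfold perimeter; field);
        reflexivity).
  rewrite E, E'.
  replace (C * (f n * total r n e) / total r n e) with (f n * C) by (field; exact N).
  replace (- (S * (f (- n) * total r n e)) / total r n e) with (- f (- n) * S) by (field;
      exact N).
  tauto.
Qed.

Lemma glides_combination n g a b c F f d G f' k : glides n g a b F f -> glides n g a b G f' ->
  (forall m, m ^ 2 = n ^ 2 -> c * f m + d * f' m = k m) ->
  glides n g a b (combination c F d G) k.
Proof.
  intros HF HG Hk C S T HT M. unfold combination.
  assert (E : (c * (a * (f n * C)) + d * (a * (f' n * C)),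
               c * (b * (- f (- n) * S)) + d * (b * (- f' (- n) * S)))
              = (a * (k n * C), b * (- k (- n) * S))).
  { rewrite <- (Hk n eq_refl), <- (Hk (- n)) by ring. f_equal; ring. }
  split.
  - intros (P & Q & HP & HQ & ->).
    apply (HF C S T HT) in HP. apply (HG C S T HT) in HQ. subst P Q. exact E.
  - intros ->.
    exists (a * (f n * C), b * (- f (- n) * S)), (a * (f' n * C), b * (- f' (- n) * S)).
    split; [apply (HF C S T HT); reflexivity|]. split; [apply (HG C S T HT); reflexivity|].
    symmetry. exact E.
Qed.

Lemma unit_circle_angle (c s : R) : c ^ 2 + s ^ 2 = 1 -> exists t, c = cos t /\ s = sin t.
Proof.
  intros H. assert (Hc : -1 <= c <= 1) by nra.
  assert (E : sqrt (1 - Rsqr c) = Rabs s).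
  { rewrite <- sqrt_Rsqr_abs. f_equal. rewrite !Rsqr_pow2. lra. }
  destruct (Rle_dec 0 s) as [Hs|Hs].
  - exists (acos c). rewrite cos_acos, sin_acos, E by exact Hc.
    rewrite Rabs_right by lra. tauto.
  - exists (- acos c). rewrite cos_neg, sin_neg, cos_acos, sin_acos, E by exact Hc.
    rewrite Rabs_left by lra. split; ring.
Qed.

Lemma Rabs_factor (p : R) : exists s, s ^ 2 = 1 /\ p = Rabs p * s.
Proof.
  destruct (Rle_dec 0 p).
  - exists 1. rewrite Rabs_right by lra. split; ring.
  - exists (- 1). rewrite Rabs_left by lra. split; ring.
Qed.

(** The signs of p and q are absorbed by reflections of the unit circle. *)
Lemma ellipse_with_axes_scaled (p q : R) (L : point -> Prop) :
  (forall M, L M <-> exists c s, c ^ 2 + s ^ 2 = 1 /\ M = (p * c, q * s)) ->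
  ellipse_with_axes (0, 0) (1, 0) (Rabs p) (Rabs q) L.
Proof.
  intros HL M. rewrite HL. simpl fst; simpl snd.
  destruct (Rabs_factor p) as (u & Hu & Hp), (Rabs_factor q) as (v & Hv & Hq).
  split.
  - intros (c & s & H & ->).
    destruct (unit_circle_angle (u * c) (v * s)) as (t & Hc & Hs).
    { transitivity (u ^ 2 * c ^ 2 + v ^ 2 * s ^ 2); [ring|]. rewrite Hu, Hv. lra. }
    exists t. rewrite <- Hc, <- Hs. f_equal.
    + transitivity (Rabs p * u * c); [rewrite <- Hp; reflexivity | ring].
    + transitivity (Rabs q * v * s); [rewrite <- Hq; reflexivity | ring].
  - intros [t ->]. exists (u * cos t), (v * sin t). split.
    + transitivity (u ^ 2 * cos t ^ 2 + v ^ 2 * sin t ^ 2); [ring|].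
      rewrite Hu, Hv, <- !Rsqr_pow2. pose proof (sin2_cos2 t). lra.
    + f_equal.
      * transitivity (Rabs p * cos t * u ^ 2); [rewrite Hu; ring|].
        transitivity (Rabs p * u * (u * cos t)); [ring | rewrite <- Hp; reflexivity].
      * transitivity (Rabs q * sin t * v ^ 2); [rewrite Hv; ring|].
        transitivity (Rabs q * v * (v * sin t)); [ring | rewrite <- Hq; reflexivity].
Qed.

(** Each triangle has a parameter (C, S) and each parameter occurs. The circle point used is (C, -
    S), matching the sign in [glides]. *)
Lemma locus_glides n g a b F f : setting n g a b -> glides n g a b F f ->
  ellipse_with_axes (0, 0) (1, 0) (Rabs (a * f n)) (Rabs (b * f (- n))) (locus a b F).
Proof.
  intros HS HF. apply ellipse_with_axes_scaled. intros M. split.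
  - intros (T & HT & HM). destruct (poncelet_orbit n g a b T HS HT) as (C & S & HO).
    apply (HF C S T HO) in HM. exists C, (- S). split.
    + destruct HO as [? ? ? ? ? ? ? ? ? ? ? ? ? ? ? HC]. rewrite <- HC. ring.
    + rewrite HM. f_equal; ring.
  - intros (C & S & HC & ->).
    destruct (orbit_exists n g a b C (- S) HS) as (T & HT & HO); [rewrite <- HC; ring|].
    exists T. split; [exact HT|]. apply (HF _ _ _ HO). f_equal; ring.
Qed.

Lemma ellipse_glides n g a b F f : setting n g a b -> glides n g a b F f ->
  (forall m, m ^ 2 = n ^ 2 -> f m <> 0) -> is_ellipse (locus a b F).
Proof.
  intros HS HF Hf. exists (0, 0), (1, 0), (Rabs (a * f n)), (Rabs (b * f (- n))).
  assert (0 < a) by apply HS. assert (0 < b) by apply HS.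
  repeat split.
  - simpl. ring.
  - apply Rabs_pos_lt, Rmult_integral_contrapositive_currified; [lra | apply Hf; reflexivity].
  - apply Rabs_pos_lt, Rmult_integral_contrapositive_currified; [lra | apply Hf; ring].
  - apply (locus_glides n g a b F f HS HF).
  - apply (locus_glides n g a b F f HS HF).
Qed.

Lemma degenerate_glides n g a b F f : setting n g a b -> glides n g a b F f ->
  f (- n) = 0 -> is_degenerate_ellipse (locus a b F).
Proof.
  intros HS HF Hf. exists (0, 0), (1, 0), (Rabs (a * f n)), (Rabs (b * f (- n))).
  split; [simpl; ring|]. split; [apply Rabs_pos|]. split; [apply Rabs_pos|].
  split; [|apply (locus_glides n g a b F f HS HF)].
  rewrite Hf, Rmult_0_r, Rabs_R0. ring.
Qed.

(** * Centers on the outer ellipse *)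

(** On the plane w1 + w2 + w3 = 0 the quadratic form is definite, as completing the square shows: an
    ellipse has no real points at infinity. *)
Lemma circumconic_weights (x y z w1 w2 w3 : R) : 0 < z ->
  0 < 4 * (x * y + y * z + z * x) - (x + y + z) ^ 2 ->
  w1 * w2 * z + w2 * w3 * x + w3 * w1 * y = 0 -> w1 + w2 + w3 = 0 ->
  w1 = 0 /\ w2 = 0 /\ w3 = 0.
Proof.
  intros Hz HG HC HW. assert (E1 : w1 = - w2 - w3) by lra.
  assert (Q : (2 * z * w2 + (y + z - x) * w3) ^ 2
              + (4 * (x * y + y * z + z * x) - (x + y + z) ^ 2) * w3 ^ 2 = 0).
  { transitivity (- 4 * z * (w1 * w2 * z + w2 * w3 * x + w3 * w1 * y));
      [rewrite E1; ring | rewrite HC; ring]. }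
  pose proof (pow2_ge_0 (2 * z * w2 + (y + z - x) * w3)).
  assert (H3 : w3 = 0).
  { destruct (Req_dec w3 0) as [|N]; [assumption|exfalso].
    pose proof (Rmult_lt_0_compat _ _ HG (pow2_gt_0 w3 N)). lra. }
  assert (H2 : (2 * z * w2) ^ 2 = 0) by (rewrite H3 in Q; etransitivity; [|exact Q]; ring).
  rewrite <- Rsqr_pow2 in H2. apply Rsqr_0_uniq, Rmult_integral in H2.
  lra.
Qed.

(** The relation among the weights is the barycentric equation of the outer ellipse: |sum w_j u_j|^2
    is (sum w_j)^2 minus twice its left side. If the total vanished, so would all weights, and the
    triangle would be equilateral. *)
Lemma orbit_circumconic n g a b C S T h mu r : setting n g a b -> reduces h mu r ->
  (forall c e, 0 < c -> 0 < e -> mu c e <> 0) ->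
  (forall x y z, 0 < x -> 0 < y -> 0 < z ->
     h x y z * h y z x * z + h y z x * h z x y * x + h z x y * h x y z * y = 0) ->
  (forall x y z, 0 < x -> 0 < y -> 0 < z ->
     h x y z = 0 -> h y z x = 0 -> h z x y = 0 -> x = y /\ y = z) ->
  orbit n g a b C S T ->
  let e := sides_product n C in
  total r n e <> 0 /\ (C * moment r n e) ^ 2 + (S * moment r (- n) e) ^ 2 = total r n e ^ 2.
Proof.
  intros HS Hr Hmu Hc Heq HT e. assert (Hg : 0 < 2 * g) by (destruct HS as (_ & ? & _); lra).
  assert (Hn : 0 < n < 1) by apply HS.
  destruct HT as [x1 y1 x2 y2 x3 y3 H1 H2 H3 Hx Hy Hz D1 D2 D3 HC Sx Sy Pr Pi].
  destruct (orbit_weighted_sums n C S x1 y1 x2 y2 x3 y3 r H1 H2 H3 HC Sx Sy Pr Pi)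
    as (Ee & W & Wx & Wy).
  destruct (orbit_sums n C S x1 y1 x2 y2 x3 y3 H1 H2 H3 HC Sx Sy Pr Pi) as (Ep & _).
  pose proof (chord_gram x1 y1 x2 y2 x3 y3 H1 H2 H3) as G.
  destruct (reduces_rotations h mu r (2 * g) _ _ _ Hr Hg Hx Hy Hz) as (R1 & R2 & R3).
  set (x := chord x2 y2 x3 y3) in *. set (y := chord x3 y3 x1 y1) in *.
  set (z := chord x1 y1 x2 y2) in *. cbv zeta in *.
  rewrite Ee in *. fold e in Ee, W, Wx, Wy, R1, R2, R3, G |- *.
  assert (He : 0 < e)
    by (rewrite <- Ee; apply Rmult_lt_0_compat; [apply Rmult_lt_0_compat|]; assumption).
  pose proof (Hmu (2 * g) e Hg He) as Hm. set (m := mu (2 * g) e) in *.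
  set (w1 := coef0 r _ _ _ + _ * x + _) in *. set (w2 := coef0 r _ _ _ + _ * y + _) in *.
  set (w3 := coef0 r _ _ _ + _ * z + _) in *.
  assert (Q : w1 * w2 * z + w2 * w3 * x + w3 * w1 * y = 0).
  { pose proof (Hc (2 * g * x) (2 * g * y) (2 * g * z)) as Q.
    rewrite R1, R2, R3 in Q.
    apply Rmult_eq_reg_l with (2 * g * m * m);
      [|repeat apply Rmult_integral_contrapositive_currified; lra].
    rewrite Rmult_0_r, <- Q by (apply Rmult_lt_0_compat; assumption). ring. }
  split.
  - intros N. rewrite <- W in N.
    destruct (circumconic_weights x y z w1 w2 w3) as (Z1 & Z2 & Z3); try assumption.
    { rewrite G. lra. }
    destruct (Heq (2 * g * x) (2 * g * y) (2 * g * z)) as [Exy Eyz];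
      try (apply Rmult_lt_0_compat; assumption).
    { rewrite R1, Z1. ring. }
    { rewrite R2, Z2. ring. }
    { rewrite R3, Z3. ring. }
    apply Rmult_eq_reg_l in Exy; [|lra]. apply Rmult_eq_reg_l in Eyz; [|lra].
    unfold perimeter in Ep. rewrite Exy, Eyz in *.
    (* Equal sides would be 3/2 by the Gram relation, making the perimeter 9/2 instead of (9 -
       n^2)/2. *)
    assert (Ez : z * z * (3 - 2 * z) = 0) by lra.
    apply Rmult_integral in Ez. destruct Ez as [Ez|Ez]; nra.
  - rewrite <- Wx, <- W.
    replace ((S * moment r (- n) e) ^ 2) with ((w1 * y1 + w2 * y2 + w3 * y3) ^ 2)
      by (rewrite Wy; ring).
    transitivity (w1 ^ 2 * (x1 ^ 2 + y1 ^ 2) + w2 ^ 2 * (x2 ^ 2 + y2 ^ 2)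
      + w3 ^ 2 * (x3 ^ 2 + y3 ^ 2) + 2 * (w1 * w2 + w2 * w3 + w3 * w1)
      - 2 * (w1 * w2 * z + w2 * w3 * x + w3 * w1 * y)).
    + unfold x, y, z, chord. ring.
    + rewrite H1, H2, H3, Q. ring.
Qed.

(** By [orbit_circumconic] the center stays on the outer ellipse. Continuity in C shows that each
    abscissa is taken, and replacing S by - S reaches both ordinates. *)
Lemma ellipse_circumconic n g a b h mu r : setting n g a b -> reduces h mu r ->
  (forall c e, 0 < c -> 0 < e -> mu c e <> 0) ->
  (forall x y z, 0 < x -> 0 < y -> 0 < z ->
     h x y z * h y z x * z + h y z x * h z x y * x + h z x y * h x y z * y = 0) ->
  (forall x y z, 0 < x -> 0 < y -> 0 < z ->
     h x y z = 0 -> h y z x = 0 -> h z x y = 0 -> x = y /\ y = z) ->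
  continuity (total r n) -> continuity (moment r n) ->
  is_ellipse (locus a b (barycentric h)).
Proof.
  intros HS Hr Hmu Hc Heq Ct Cm.
  assert (Ha : 0 < a) by apply HS. assert (Hb : 0 < b) by apply HS.
  assert (HB := fun C S T => orbit_barycentric n g a b C S T h mu r HS Hr Hmu).
  assert (HQ := fun C S T => orbit_circumconic n g a b C S T h mu r HS Hr Hmu Hc Heq).
  exists (0, 0), (1, 0), (Rabs a), (Rabs b).
  split; [simpl; ring|]. split; [apply Rabs_pos_lt; lra|]. split; [apply Rabs_pos_lt; lra|].
  apply ellipse_with_axes_scaled. intros M. split.
  - intros (T & HT & HM). destruct (poncelet_orbit n g a b T HS HT) as (C & S & HO).
    destruct (HQ C S T HO) as [N E]. apply (HB C S T HO) in HM. destruct HM as [_ ->].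
    exists (C * moment r n (sides_product n C) / total r n (sides_product n C)),
      (- (S * moment r (- n) (sides_product n C)) / total r n (sides_product n C)).
    split; [|reflexivity].
    transitivity (((C * moment r n (sides_product n C)) ^ 2 + (S * moment r (- n) (sides_product n C)) ^ 2)
                  / total r n (sides_product n C) ^ 2); [field; exact N|].
    rewrite E. field. exact N.
  - intros (c & s & Hcs & ->).
    set (f := fun C => C * moment r n (sides_product n C) - c * total r n (sides_product n C)).
    assert (Cv : continuity (sides_product n)) by (unfold sides_product; reg).
    destruct (orbit_exists n g a b 1 0 HS) as (T1 & _ & HO1); [ring|].
    destruct (HQ 1 0 T1 HO1) as [N1 E1].
    assert (V1 : sides_product n (-1) = sides_product n 1) by (unfold sides_product; field).
    destruct (IVT_cor f (-1) 1) as [C [HC Hf]].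
    + unfold f. apply continuity_minus; apply continuity_mult.
      * apply derivable_continuous, derivable_id.
      * exact (continuity_comp (sides_product n) (moment r n) Cv Cm).
      * apply continuity_const. intros ? ?. reflexivity.
      * exact (continuity_comp (sides_product n) (total r n) Cv Ct).
    + lra.
    (* At C = 1 the parameter S is 0, so m^2 = t^2; the side product is even in C, so the end values
       of f multiply to (c^2 - 1) t^2 <= 0. *)
    + unfold f. rewrite V1.
      set (m := moment r n (sides_product n 1)) in *. set (t := total r n (sides_product n 1)) in *.
      assert (m ^ 2 = t ^ 2) by lra.
      assert (0 <= s ^ 2 * t ^ 2) by (apply Rmult_le_pos; apply pow2_ge_0).
      replace (s ^ 2) with (1 - c ^ 2) in * by lra. nra.
    + set (S := sqrt (1 - C ^ 2)).
      assert (HS2 : S ^ 2 = 1 - C ^ 2) by (apply pow2_sqrt; nra).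
      destruct (orbit_exists n g a b C S HS) as (T & HT & HO); [lra|].
      destruct (orbit_exists n g a b C (- S) HS) as (T' & HT' & HO'); [nra|].
      destruct (HQ C S T HO) as [N E].
      unfold f in Hf.
      set (m := moment r n (sides_product n C)) in *. set (m' := moment r (- n) (sides_product n C)) in *.
      set (t := total r n (sides_product n C)) in *.
      assert (Ec : C * m / t = c).
      { replace (C * m) with (c * t) by lra. field. exact N. }
      (* The equation of the outer ellipse gives S m' up to sign; the sign decides between S and -
         S, which share the same side product. *)
      assert (Z : (S * m' + s * t) * (S * m' - s * t) = 0).
      { transitivity ((S * m') ^ 2 - s ^ 2 * t ^ 2); [ring|].
        replace ((S * m') ^ 2) with (t ^ 2 - (C * m) ^ 2) by lra.
        replace (C * m) with (c * t) by lra. replace (s ^ 2) with (1 - c ^ 2) by lra. ring. }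
      apply Rmult_integral in Z. destruct Z as [Z|Z].
      * exists T. split; [exact HT|]. apply (HB C S T HO). split; [exact N|].
        fold m m' t. rewrite Ec. f_equal. f_equal.
        replace (S * m') with (- (s * t)) by lra. field. exact N.
      * exists T'. split; [exact HT'|]. apply (HB C (- S) T' HO'). split; [exact N|].
        fold m m' t. rewrite Ec. f_equal. f_equal.
        replace (- S * m') with (- (s * t)) by lra. field. exact N.
Qed.

(** * The individual centers *)

(** Here m stands for n or - n, that is, for either axis. *)
Lemma signed_parameter (n g a b m : R) : setting n g a b -> m ^ 2 = n ^ 2 ->
  -1 < m < 1 /\ m <> 0 /\ 0 < m ^ 2 < 1.
Proof.
  intros HS Hm. assert (Hn : 0 < n < 1) by apply HS.
  assert (0 < n ^ 2 < 1) by nra. rewrite <- Hm in *. repeat split; nra.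
Qed.

Ltac nonzero := repeat first
  [ assumption | lra | apply Rmult_integral_contrapositive_currified | apply pow_nonzero
  | apply Rinv_neq_0_compat | nra ].

Ltac weights_reduce :=
  intros c x y z Hc Hx Hy Hz; cbn [coef0 coef1 coef2]; unfold kappa; field; repeat split; nonzero.

Ltac glide_total v :=
  match goal with
  | |- total ?r ?m ?e <> 0 /\ moment ?r ?m ?e = ?f * total ?r ?m ?e =>
      replace (total r m e) with (v m e)
        by (unfold total, perimeter; cbn [coef0 coef1 coef2]; field);
      unfold moment, perimeter; cbn [coef0 coef1 coef2];
      split; [nonzero | field; repeat split; nonzero]
  end.

(** The arguments are the common factor, the weight reduced modulo the cubic with roots x, y, z, and
    a factorised form of [total] from which its nonvanishing can be read off. *)
Ltac barycentric_glide mu r v :=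
  let HS := fresh in intros HS;
  apply (glides_barycentric _ _ _ _ _ mu r _ HS);
  [ weights_reduce
  | intros; unfold Rdiv; nonzero
  | let m := fresh "m" in let e := fresh "e" in let Hm := fresh in
    intros m e Hm ?; destruct (signed_parameter _ _ _ _ m HS Hm) as (? & ? & ?);
    glide_total v ].

Ltac combination_glide H1 H2 :=
  let HS := fresh in intros HS;
  eapply glides_combination; [apply (H1 _ _ _ _ HS) | apply (H2 _ _ _ _ HS) |];
  let m := fresh "m" in let Hm := fresh in
  intros m Hm; destruct (signed_parameter _ _ _ _ m HS Hm) as (? & ? & ?); cbv beta;
  field; repeat split; nonzero.

Lemma glides_X1 n g a b : setting n g a b ->
  glides n g a b X1 (fun m => - (2 * m) / (3 - m)).
Proof.
  barycentric_glide (fun c e : R => c)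
    (Quadratic (fun e1 e2 e3 => 0)
      (fun e1 e2 e3 => 1)
      (fun e1 e2 e3 => 0))
    (fun m e : R => (1 / 2) * (3 - m) * (3 + m)).
Qed.

Lemma glides_X2 n g a b : setting n g a b ->
  glides n g a b X2 (fun m => - m / 3).
Proof.
  barycentric_glide (fun c e : R => 1)
    (Quadratic (fun e1 e2 e3 => 1)
      (fun e1 e2 e3 => 0)
      (fun e1 e2 e3 => 0))
    (fun m e : R => 3).
Qed.

Lemma glides_X3 n g a b : setting n g a b ->
  glides n g a b X3 (fun m => m * (1 - m) / ((1 + m) * (3 - m))).
Proof.
  barycentric_glide (fun c e : R => c ^ 4)
    (Quadratic (fun e1 e2 e3 => - 2 * e1 * e3)
      (fun e1 e2 e3 => 2 * e1 * e2 - 2 * e3)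
      (fun e1 e2 e3 => - e1 ^ 2))
    (fun m e : R => (1 / 2) * e * (1 - m) * (1 + m) * (3 - m) * (3 + m)).
Qed.

Lemma glides_X4 n g a b : setting n g a b ->
  glides n g a b X4 (fun m => - m * (5 - m ^ 2) / ((1 + m) * (3 - m))).
Proof. combination_glide glides_X2 glides_X3. Qed.

Lemma glides_X5 n g a b : setting n g a b ->
  glides n g a b X5 (fun m => m * (m ^ 2 - m - 4) / (2 * (1 + m) * (3 - m))).
Proof. combination_glide glides_X2 glides_X3. Qed.

Lemma glides_X7 n g a b : setting n g a b ->
  glides n g a b X7 (fun m => - m).
Proof.
  barycentric_glide (fun c e : R => c ^ 2)
    (Quadratic (fun e1 e2 e3 => - e1 ^ 2 + 4 * e2)
      (fun e1 e2 e3 => - 2 * e1)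
      (fun e1 e2 e3 => 4))
    (fun m e : R => 2 * e).
Qed.

Lemma glides_X8 n g a b : setting n g a b ->
  glides n g a b X8 (fun m => m * (1 + m) / (3 - m)).
Proof.
  barycentric_glide (fun c e : R => c)
    (Quadratic (fun e1 e2 e3 => e1)
      (fun e1 e2 e3 => - 2)
      (fun e1 e2 e3 => 0))
    (fun m e : R => (1 / 2) * (3 - m) * (3 + m)).
Qed.

(** The stationary mittenpunkt; it enters through [X142]. *)
Lemma glides_X9 n g a b : setting n g a b ->
  glides n g a b X9 (fun m => 0).
Proof.
  barycentric_glide (fun c e : R => c ^ 2)
    (Quadratic (fun e1 e2 e3 => 0)
      (fun e1 e2 e3 => e1)
      (fun e1 e2 e3 => - 2))
    (fun m e : R => 2 * e).
Qed.

Lemma glides_X10 n g a b : setting n g a b ->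
  glides n g a b X10 (fun m => - m * (1 - m) / (2 * (3 - m))).
Proof.
  barycentric_glide (fun c e : R => c)
    (Quadratic (fun e1 e2 e3 => e1)
      (fun e1 e2 e3 => - 1)
      (fun e1 e2 e3 => 0))
    (fun m e : R => (3 - m) * (3 + m)).
Qed.

(** The resulting ratios (1 + n)/2 and (1 - n)/2 are those of the caustic, on which this center
    moves. *)
Lemma glides_X11 n g a b : setting n g a b ->
  glides n g a b X11 (fun m => - (1 + m) / 2).
Proof.
  barycentric_glide (fun c e : R => c ^ 3)
    (Quadratic (fun e1 e2 e3 => e1 ^ 3 - 4 * e1 * e2 + 6 * e3)
      (fun e1 e2 e3 => 2 * e2)
      (fun e1 e2 e3 => - e1))
    (fun m e : R => 2 * e * m ^ 2).
Qed.

Lemma glides_X12 n g a b : setting n g a b ->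
  glides n g a b X12 (fun m => m * (2 * m ^ 2 - m ^ 3 + 3 * m - 8) / (2 * (3 - m) * (2 - m ^ 2))).
Proof.
  barycentric_glide (fun c e : R => c ^ 4)
    (Quadratic (fun e1 e2 e3 => - e1 ^ 4 + 4 * e1 ^ 2 * e2 - 6 * e1 * e3)
      (fun e1 e2 e3 => - 2 * e1 * e2 + 4 * e3)
      (fun e1 e2 e3 => e1 ^ 2))
    (fun m e : R => e * (3 - m) * (3 + m) * (2 - m ^ 2)).
Qed.

Lemma glides_X20 n g a b : setting n g a b ->
  glides n g a b X20 (fun m => m * (7 - 2 * m - m ^ 2) / ((1 + m) * (3 - m))).
Proof. combination_glide glides_X3 glides_X2. Qed.

Lemma glides_X21 n g a b : setting n g a b ->
  glides n g a b X21 (fun m => - m * (1 + m) / ((2 + m) * (3 - m))).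
Proof.
  barycentric_glide (fun c e : R => c ^ 4)
    (Quadratic (fun e1 e2 e3 => - e1 * e3)
      (fun e1 e2 e3 => 2 * e1 * e2 - 2 * e3)
      (fun e1 e2 e3 => - e1 ^ 2))
    (fun m e : R => (1 / 2) * e * (3 - m) * (3 + m) * (2 - m) * (2 + m)).
Qed.

Lemma glides_X35 n g a b : setting n g a b ->
  glides n g a b X35 (fun m => m * (m ^ 2 - 2 * m - 1) / ((3 - m) * (2 - m ^ 2))).
Proof.
  barycentric_glide (fun c e : R => c / e)
    (Quadratic (fun e1 e2 e3 => - 2 * e1 * e3)
      (fun e1 e2 e3 => 2 * e1 * e2 - e3)
      (fun e1 e2 e3 => - e1 ^ 2))
    (fun m e : R => (1 / 2) * e * (3 - m) * (3 + m) * (2 - m ^ 2)).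
Qed.

Lemma glides_X36 n g a b : setting n g a b ->
  glides n g a b X36 (fun m => - (m ^ 2 - 2 * m + 3) / (m * (3 - m))).
Proof.
  barycentric_glide (fun c e : R => c / e)
    (Quadratic (fun e1 e2 e3 => 2 * e1 * e3)
      (fun e1 e2 e3 => - 2 * e1 * e2 + 3 * e3)
      (fun e1 e2 e3 => e1 ^ 2))
    (fun m e : R => (1 / 2) * e * m ^ 2 * (3 - m) * (3 + m)).
Qed.

Lemma glides_X40 n g a b : setting n g a b ->
  glides n g a b X40 (fun m => 4 * m / ((1 + m) * (3 - m))).
Proof. combination_glide glides_X3 glides_X1. Qed.

Lemma glides_X46 n g a b : setting n g a b ->
  glides n g a b X46 (fun m => - (4 * m * (2 - m)) / ((3 - m) * (1 + m ^ 2))).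
Proof.
  barycentric_glide (fun c e : R => c / (2 * e))
    (Quadratic (fun e1 e2 e3 => 4 * e1 * e3)
      (fun e1 e2 e3 => - e1 ^ 3 - 2 * e3)
      (fun e1 e2 e3 => 2 * e1 ^ 2))
    (fun m e : R => (1 / 2) * e * (3 - m) * (3 + m) * (1 + m ^ 2)).
Qed.

Lemma glides_X55 n g a b : setting n g a b ->
  glides n g a b X55 (fun m => - m * (1 + m) / (3 - m ^ 2)).
Proof.
  barycentric_glide (fun c e : R => c ^ 3)
    (Quadratic (fun e1 e2 e3 => - 2 * e3)
      (fun e1 e2 e3 => 2 * e2)
      (fun e1 e2 e3 => - e1))
    (fun m e : R => e * (3 - m ^ 2)).
Qed.

Lemma glides_X56 n g a b : setting n g a b ->
  glides n g a b X56 (fun m => - m * (m ^ 2 - 2 * m + 5) / ((3 - m) * (1 + m ^ 2))).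
Proof.
  barycentric_glide (fun c e : R => c ^ 4)
    (Quadratic (fun e1 e2 e3 => 2 * e1 * e3)
      (fun e1 e2 e3 => - 2 * e1 * e2 + 4 * e3)
      (fun e1 e2 e3 => e1 ^ 2))
    (fun m e : R => (1 / 2) * e * (3 - m) * (3 + m) * (1 + m ^ 2)).
Qed.

Lemma glides_X57 n g a b : setting n g a b ->
  glides n g a b X57 (fun m => - (4 * m) / (3 + m ^ 2)).
Proof.
  barycentric_glide (fun c e : R => c ^ 3)
    (Quadratic (fun e1 e2 e3 => 4 * e3)
      (fun e1 e2 e3 => - e1 ^ 2)
      (fun e1 e2 e3 => 2 * e1))
    (fun m e : R => e * (3 + m ^ 2)).
Qed.

Lemma glides_X63 n g a b : setting n g a b ->
  glides n g a b X63 (fun m => 2 * m / (3 - m ^ 2)).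
Proof.
  barycentric_glide (fun c e : R => c ^ 3)
    (Quadratic (fun e1 e2 e3 => - 2 * e3)
      (fun e1 e2 e3 => e1 ^ 2)
      (fun e1 e2 e3 => - 2 * e1))
    (fun m e : R => e * (3 - m ^ 2)).
Qed.

Lemma glides_X65 n g a b : setting n g a b ->
  glides n g a b X65 (fun m => m * (m ^ 2 + 2 * m - 7) / (2 * (3 - m))).
Proof.
  barycentric_glide (fun c e : R => c ^ 4)
    (Quadratic (fun e1 e2 e3 => 2 * e1 * e3)
      (fun e1 e2 e3 => - e1 ^ 3 + 2 * e1 * e2 - 4 * e3)
      (fun e1 e2 e3 => e1 ^ 2))
    (fun m e : R => e * (3 - m) * (3 + m)).
Qed.

Lemma glides_X72 n g a b : setting n g a b ->
  glides n g a b X72 (fun m => m * (5 - m ^ 2) / (2 * (3 - m))).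
Proof.
  barycentric_glide (fun c e : R => c ^ 4)
    (Quadratic (fun e1 e2 e3 => 0)
      (fun e1 e2 e3 => e1 ^ 3 - 2 * e1 * e2 + 2 * e3)
      (fun e1 e2 e3 => - e1 ^ 2))
    (fun m e : R => e * (3 - m) * (3 + m)).
Qed.

Lemma glides_X78 n g a b : setting n g a b ->
  glides n g a b X78 (fun m => 2 * m * (1 + m) * (2 - m) / ((3 - m) * (1 + m ^ 2))).
Proof.
  barycentric_glide (fun c e : R => c ^ 4)
    (Quadratic (fun e1 e2 e3 => 2 * e1 * e3)
      (fun e1 e2 e3 => e1 ^ 3 - 4 * e1 * e2 + 4 * e3)
      (fun e1 e2 e3 => 0))
    (fun m e : R => (1 / 2) * e * (3 - m) * (3 + m) * (1 + m ^ 2)).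
Qed.

Lemma glides_X79 n g a b : setting n g a b ->
  glides n g a b X79 (fun m => - m * (7 - m ^ 2) / ((2 + m) * (3 - m))).
Proof.
  barycentric_glide (fun c e : R => c ^ 4)
    (Quadratic (fun e1 e2 e3 => - e1 ^ 4 + 4 * e1 ^ 2 * e2 - 2 * e1 * e3)
      (fun e1 e2 e3 => - e1 ^ 3 - 2 * e1 * e2 + e3)
      (fun e1 e2 e3 => 3 * e1 ^ 2))
    (fun m e : R => (1 / 2) * e * (3 - m) * (3 + m) * (2 - m) * (2 + m)).
Qed.

Lemma glides_X80 n g a b : setting n g a b ->
  glides n g a b X80 (fun m => - (3 - m ^ 2) / (3 - m)).
Proof. combination_glide glides_X11 glides_X1. Qed.

Lemma glides_X84 n g a b : setting n g a b ->
  glides n g a b X84 (fun m => - (8 * m) / ((1 + m) ^ 2 * (3 - m))).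
Proof.
  barycentric_glide (fun c e : R => c / (4 * e ^ 2))
    (Quadratic (fun e1 e2 e3 => 16 * e1 * e3 ^ 2)
      (fun e1 e2 e3 => - e1 ^ 6 + 4 * e1 ^ 4 * e2 - 8 * e1 ^ 3 * e3 - 16 * e1 * e2 * e3
          + 16 * e3 ^ 2)
      (fun e1 e2 e3 => 2 * e1 ^ 5 - 8 * e1 ^ 3 * e2 + 24 * e1 ^ 2 * e3))
    (fun m e : R => (1 / 2) * e ^ 2 * (1 - m) ^ 2 * (1 + m) ^ 2 * (3 - m) * (3 + m)).
Qed.

(** The total contains (m^2 + 2m - 1)(m^2 - 2m - 1). If n^2 + 2n - 1 = 0 it vanishes for the whole
    family and the center never has a position. *)
Lemma glides_X90 n g a b : setting n g a b -> (forall m, m ^ 2 = n ^ 2 -> m ^ 2 + 2 * m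
    - 1 <> 0) ->
  glides n g a b X90 (fun m => - (4 * m) / ((3 - m) * (m ^ 2 + 2 * m - 1))).
Proof.
  intros HS Hex. apply (glides_barycentric _ _ _ _ _ (fun c e => c / (4 * e ^ 2))
    (Quadratic (fun e1 e2 e3 => 8 * e1 * e3 ^ 2)
      (fun e1 e2 e3 => - e1 ^ 6 + 4 * e1 ^ 4 * e2 - 8 * e1 ^ 3 * e3 - 8 * e1 * e2 * e3
          + 4 * e3 ^ 2)
      (fun e1 e2 e3 => 2 * e1 ^ 5 - 8 * e1 ^ 3 * e2 + 20 * e1 ^ 2 * e3)) _ HS).
  - weights_reduce.
  - intros; unfold Rdiv; nonzero.
  - intros m e Hm He. destruct (signed_parameter _ _ _ _ m HS Hm) as (? & ? & ?).
    pose proof (Hex m Hm).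
    assert (m ^ 2 - 2 * m - 1 <> 0)
      by (pose proof (Hex (- m)) as Hex'; intros Z; apply Hex'; [rewrite <- Hm; ring | lra]).
    glide_total (fun m e : R => (1 / 2) * e ^ 2 * (3 - m) * (3 + m) * (m ^ 2 + 2 * m
        - 1) * (m ^ 2 - 2 * m - 1)).
Qed.

(** The constant 1 makes the locus the outer ellipse itself. *)
Lemma glides_X100 n g a b : setting n g a b ->
  glides n g a b X100 (fun m => 1).
Proof. combination_glide glides_X2 glides_X11. Qed.

Lemma glides_X104 n g a b : setting n g a b ->
  glides n g a b X104 (fun m => - (3 + m ^ 2) / ((1 + m) * (3 - m))).
Proof. combination_glide glides_X3 glides_X100. Qed.

Lemma glides_X119 n g a b : setting n g a b ->
  glides n g a b X119 (fun m => (1 - m) * (3 - m ^ 2) / (2 * (1 + m) * (3 - m))).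
Proof. combination_glide glides_X5 glides_X11. Qed.

Lemma glides_X140 n g a b : setting n g a b ->
  glides n g a b X140 (fun m => m * (m ^ 2 - 3 * m - 2) / (4 * (1 + m) * (3 - m))).
Proof. combination_glide glides_X3 glides_X5. Qed.

Lemma glides_X142 n g a b : setting n g a b ->
  glides n g a b X142 (fun m => - m / 2).
Proof. combination_glide glides_X2 glides_X9. Qed.

Lemma glides_X144 n g a b : setting n g a b ->
  glides n g a b X144 (fun m => m).
Proof. combination_glide glides_X2 glides_X7. Qed.

Lemma glides_X145 n g a b : setting n g a b ->
  glides n g a b X145 (fun m => - m * (5 + m) / (3 - m)).
Proof. combination_glide glides_X2 glides_X8. Qed.

Lemma glides_X149 n g a b : setting n g a b ->
  glides n g a b X149 (fun m => - (2 + m)).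
Proof. combination_glide glides_X2 glides_X100. Qed.

Lemma glides_X153 n g a b : setting n g a b ->
  glides n g a b X153 (fun m => (m ^ 3 - 3 * m + 6) / ((1 + m) * (3 - m))).
Proof. combination_glide glides_X2 glides_X104. Qed.

Lemma glides_X165 n g a b : setting n g a b ->
  glides n g a b X165 (fun m => 2 * m / (3 * (1 + m))).
Proof. combination_glide glides_X3 glides_X1. Qed.

Lemma glides_X191 n g a b : setting n g a b ->
  glides n g a b X191 (fun m => 2 * m / ((2 + m) * (3 - m))).
Proof. combination_glide glides_X21 glides_X1. Qed.

Lemma glides_X200 n g a b : setting n g a b ->
  glides n g a b X200 (fun m => 2 * m * (1 + m) / (3 + m ^ 2)).
Proof.
  barycentric_glide (fun c e : R => c ^ 3)
    (Quadratic (fun e1 e2 e3 => 4 * e3)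
      (fun e1 e2 e3 => e1 ^ 2 - 4 * e2)
      (fun e1 e2 e3 => 0))
    (fun m e : R => e * (3 + m ^ 2)).
Qed.

Lemma pairwise_products_vanish (p q r d1 d2 d3 : R) : 0 < p -> 0 < q -> 0 < r ->
  p * d2 * d3 = 0 -> q * d3 * d1 = 0 -> r * d1 * d2 = 0 -> d1 + d2 + d3 = 0 ->
  d1 = 0 /\ d2 = 0 /\ d3 = 0.
Proof.
  intros Hp Hq Hr P Q W HD. rewrite Rmult_assoc in P, Q, W.
  apply Rmult_integral in P, Q, W.
  destruct P as [|P], Q as [|Q], W as [|W]; try lra.
  apply Rmult_integral in P, Q, W. lra.
Qed.

(** With denominators d_j, the conic relation reduces to d1 + d2 + d3 = 0 for [X88] and [X162], and
    to x d1 + y d2 + z d3 = 0 for [X190]. The goal left open is that only equal sides make all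
    weights vanish. *)
Ltac circumconic_ellipse mu r :=
  let HS := fresh in intros HS;
  apply (ellipse_circumconic _ _ _ _ _ mu r HS);
  [ weights_reduce
  | intros; nonzero
  | intros; ring
  |
  | unfold total, perimeter; cbn [coef0 coef1 coef2]; reg
  | unfold moment, perimeter; cbn [coef0 coef1 coef2]; reg ];
  intros x y z Hx Hy Hz P Q W.

Lemma ellipse_X88 n g a b : setting n g a b -> is_ellipse (locus a b X88).
Proof.
  circumconic_ellipse (fun c e : R => c ^ 3)
    (Quadratic (fun e1 e2 e3 => 9 * e3)
      (fun e1 e2 e3 => - 2 * e1 ^ 2)
      (fun e1 e2 e3 => 3 * e1)).
  destruct (pairwise_products_vanish x y z _ _ _ Hx Hy Hz P Q W) as (D1 & D2 & D3); lra.
Qed.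

Lemma ellipse_X162 n g a b : setting n g a b -> is_ellipse (locus a b X162).
Proof.
  circumconic_ellipse (fun c e : R => c ^ 9)
    (Quadratic (fun e1 e2 e3 => - e1 ^ 6 * e3 + 7 * e1 ^ 4 * e2 * e3
        - 12 * e1 ^ 2 * e2 ^ 2 * e3 - 8 * e1 ^ 3 * e3 ^ 2 + 24 * e1 * e2 * e3 ^ 2 - 12 * e3 ^ 3)
      (fun e1 e2 e3 => e1 ^ 6 * e2 - 6 * e1 ^ 4 * e2 ^ 2 - e1 ^ 5 * e3 + 8 * e1 ^ 2 * e2 ^ 3
          + 12 * e1 ^ 3 * e2 * e3 - 16 * e1 * e2 ^ 2 * e3 - 6 * e1 ^ 2 * e3 ^ 2 + 8 * e2 * e3 ^ 2)
      (fun e1 e2 e3 => - e1 ^ 7 + 6 * e1 ^ 5 * e2 - 8 * e1 ^ 3 * e2 ^ 2 - 7 * e1 ^ 4 * e3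
          + 12 * e1 ^ 2 * e2 * e3 - 4 * e1 * e3 ^ 2)).
  destruct (pairwise_products_vanish x y z _ _ _ Hx Hy Hz P Q W) as (D1 & D2 & D3); [ring|].
  apply Rmult_integral in D1, D2, D3.
  (* Each factor means two equal sides or a right angle; two right angles, or a leg equal to the
     hypotenuse, would give a zero side. *)
  destruct D1 as [D1|D1], D2 as [D2|D2], D3 as [D3|D3]; split; nra.
Qed.

Lemma ellipse_X190 n g a b : setting n g a b -> is_ellipse (locus a b X190).
Proof.
  circumconic_ellipse (fun c e : R => c ^ 2)
    (Quadratic (fun e1 e2 e3 => - e2)
      (fun e1 e2 e3 => 2 * e1)
      (fun e1 e2 e3 => - 3)).
  destruct (pairwise_products_vanish 1 1 1 _ _ _ Rlt_0_1 Rlt_0_1 Rlt_0_1 P Q W)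
    as (D1 & D2 & D3); lra.
Qed.

(** The shape n = sqrt 2 - 1, exceptional for [X35] and [X90]. *)
Lemma bisection_ratio n g a b : setting n g a b -> n ^ 2 + 2 * n - 1 = 0 ->
  a ^ 2 = (2 * sqrt 2 - 1) * b ^ 2.
Proof.
  intros (Hn & _ & _ & _ & Ea & Eb & _) H.
  assert (E : sqrt 2 = n + 1) by (apply sqrt_lem_1; nra).
  rewrite E, Ea, Eb.
  apply Rminus_diag_uniq.
  transitivity (2 * g ^ 2 * n * (n ^ 2 + 2 * n - 1)); [|rewrite H]; ring.
Qed.

(** For m = - n the value n^2 - 2n - 1 is negative, so only m = n could give a zero. *)
Lemma signed_quadratic (n m : R) : 0 < n < 1 -> n ^ 2 + 2 * n - 1 <> 0 -> m ^ 2 = n ^ 2 ->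
  m ^ 2 + 2 * m - 1 <> 0.
Proof.
  intros Hn H Hm. assert (E : (m - n) * (m + n) = 0) by lra.
  apply Rmult_integral in E. destruct E as [E|E].
  - replace m with n by lra. exact H.
  - replace m with (- n) by lra. nra.
Qed.

Ltac gliding_ellipse H :=
  left;
  match goal with
  | HS : setting ?n ?g ?a ?b |- _ =>
      apply (ellipse_glides _ _ _ _ _ _ HS (H n g a b HS));
      let m := fresh "m" in let Hm := fresh in
      intros m Hm; destruct (signed_parameter n g a b m HS Hm) as (? & ? & ?);
      unfold Rdiv; nonzero
  end.

Theorem corollary3 : forall (a b : R) (k : nat),
  0 < b -> b < a ->
  In k [1; 2; 3; 4; 5; 7; 8; 10; 11; 12; 20; 21; 35; 36; 40; 46; 55; 56; 57;
        63; 65; 72; 78; 79; 80; 84; 88; 90; 100; 104; 119; 140; 142; 144; 145;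
        149; 153; 162; 165; 190; 191; 200]%nat ->
  ~ (k = 90%nat /\ a ^ 2 = (2 * sqrt 2 - 1) * b ^ 2) ->
  is_ellipse (locus a b (X k)) \/
  (((k = 35%nat /\ a ^ 2 = (2 * sqrt 2 - 1) * b ^ 2) \/
    (k = 140%nat /\ a ^ 2 = (9 - sqrt 17) / 2 * b ^ 2)) /\
   is_degenerate_ellipse (locus a b (X k))).
Proof.
  intros a b k Hb Hab Hk H90.
  destruct (confocal_parameters a b Hb Hab) as (n & g & Hn & Hg & Ea & Eb & Ex & Ey).
  assert (HS : setting n g a b) by (unfold setting; repeat split; try assumption; lra).
  cbn [In] in Hk. repeat (destruct Hk as [<-|Hk]); [..|destruct Hk]; cbn [X].
  - gliding_ellipse glides_X1.
  - gliding_ellipse glides_X2.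
  - gliding_ellipse glides_X3.
  - gliding_ellipse glides_X4.
  - gliding_ellipse glides_X5.
  - gliding_ellipse glides_X7.
  - gliding_ellipse glides_X8.
  - gliding_ellipse glides_X10.
  - gliding_ellipse glides_X11.
  - gliding_ellipse glides_X12.
  - gliding_ellipse glides_X20.
  - gliding_ellipse glides_X21.
  (* Up to a nonzero factor this is f (- n), the vertical semi-axis of the locus. *)
  - destruct (Req_dec (n ^ 2 + 2 * n - 1) 0) as [Z|Z].
    + right. split; [left; split; [reflexivity | exact (bisection_ratio n g a b HS Z)]|].
      apply (degenerate_glides _ _ _ _ _ _ HS (glides_X35 n g a b HS)).
      replace ((- n) ^ 2 - 2 * - n - 1) with (n ^ 2 + 2 * n - 1) by ring.
      rewrite Z. unfold Rdiv. ring.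
    + left. apply (ellipse_glides _ _ _ _ _ _ HS (glides_X35 n g a b HS)).
      intros m Hm. destruct (signed_parameter n g a b m HS Hm) as (? & ? & ?).
      assert (m ^ 2 - 2 * m - 1 <> 0).
      { replace (m ^ 2 - 2 * m - 1) with ((- m) ^ 2 + 2 * - m - 1) by ring.
        apply (signed_quadratic n); [exact Hn | exact Z | rewrite <- Hm; ring]. }
      unfold Rdiv; nonzero.
  - gliding_ellipse glides_X36.
  - gliding_ellipse glides_X40.
  - gliding_ellipse glides_X46.
  - gliding_ellipse glides_X55.
  - gliding_ellipse glides_X56.
  - gliding_ellipse glides_X57.
  - gliding_ellipse glides_X63.
  - gliding_ellipse glides_X65.
  - gliding_ellipse glides_X72.
  - gliding_ellipse glides_X78.
  - gliding_ellipse glides_X79.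
  - gliding_ellipse glides_X80.
  - gliding_ellipse glides_X84.
  - left. exact (ellipse_X88 n g a b HS).
  - left.
    assert (Z : forall m, m ^ 2 = n ^ 2 -> m ^ 2 + 2 * m - 1 <> 0).
    { intros m. apply signed_quadratic; [exact Hn|]. intros Z. apply H90.
      split; [reflexivity | exact (bisection_ratio n g a b HS Z)]. }
    apply (ellipse_glides _ _ _ _ _ _ HS (glides_X90 n g a b HS Z)).
    intros m Hm. destruct (signed_parameter n g a b m HS Hm) as (? & ? & ?).
    pose proof (Z m Hm). unfold Rdiv; nonzero.
  - gliding_ellipse glides_X100.
  - gliding_ellipse glides_X104.
  - gliding_ellipse glides_X119.
  (* Again the vertical semi-axis up to a nonzero factor; its root is n = (sqrt 17 - 3)/2. The
     horizontal counterpart n^2 - 3n - 2 is negative. *)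
  - destruct (Req_dec (n ^ 2 + 3 * n - 2) 0) as [Z|Z].
    + right. split.
      * right. split; [reflexivity|].
        assert (E : sqrt 17 = 2 * n + 3) by (apply sqrt_lem_1; nra).
        rewrite E, Ea, Eb. apply Rminus_diag_uniq.
        transitivity (g ^ 2 * (3 - n) * (n ^ 2 + 3 * n - 2)); [|rewrite Z]; field.
      * apply (degenerate_glides _ _ _ _ _ _ HS (glides_X140 n g a b HS)).
        replace ((- n) ^ 2 - 3 * - n - 2) with (n ^ 2 + 3 * n - 2) by ring.
        rewrite Z. unfold Rdiv. ring.
    + left. apply (ellipse_glides _ _ _ _ _ _ HS (glides_X140 n g a b HS)).
      intros m Hm. destruct (signed_parameter n g a b m HS Hm) as (? & ? & ?).
      assert (m ^ 2 - 3 * m - 2 <> 0).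
      { assert (E : (m - n) * (m + n) = 0) by lra.
        apply Rmult_integral in E. destruct E as [E|E].
        - replace m with n by lra. nra.
        - replace m with (- n) by lra. lra. }
      unfold Rdiv; nonzero.
  - gliding_ellipse glides_X142.
  - gliding_ellipse glides_X144.
  - gliding_ellipse glides_X145.
  - gliding_ellipse glides_X149.
  - gliding_ellipse glides_X153.
  - left. exact (ellipse_X162 n g a b HS).
  - gliding_ellipse glides_X165.
  - left. exact (ellipse_X190 n g a b HS).
  - gliding_ellipse glides_X191.
  - gliding_ellipse glides_X200.
Qed.
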